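(* Let $(X,\pi,M,G)$ be a smooth principal bundle, and let the group $\mathcal{G}(X)$ of gauge transformations act on the spaces $\mathcal{P}(X)$, $\mathcal{F}(X)$, $\mathcal{D}(X)$ of connections, connection forms and exterior covariant differentiations, respectively, by $$\Pi^\gamma:=(\gamma^{-1})^*\circ\Pi\circ\gamma^*,\qquad \omega^\gamma:=(\gamma^{-1})^*\circ\omega,\qquad D^\gamma:=(\gamma^{-1})^*\circ D\circ\gamma^*.$$ Then the following formulas define $\mathcal{G}(X)$-equivariant affine isomorphisms: $$j_{dp}:\mathcal{D}(X)\ni D\mapsto\Pi^D\in\mathcal{P}(X),\quad \Pi^D(\mathrm{d}f):=(\mathrm{d}-D)f;$$ $$j_{pf}:\mathcal{P}(X)\ni\Pi\mapsto\omega^\Pi\in\mathcal{F}(X),\quad (\omega^\Pi(h))(Y_x):=(\mathrm{ver}^\Pi Y_x)(R_{\check{x}}^{*}h);$$ $$j_{fd}:\mathcal{F}(X)\ni\omega\mapsto D^\omega\in\mathcal{D}(X),\quad (D^\omega(f))(Y_x):=\big(\mathrm{d}f-\omega(R_x^{*}f)\big)(Y_x).$$ Here $f\in C^\infty(X)$, $h\in C^\infty(G)$, $Y_x\in T_xX$, and $\mathrm{ver}^\Pi Y_x$ is defined by $(\mathrm{ver}^\Pi Y_x)(f):=(\Pi(\mathrm{d}f))(Y_x)$.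
   Context: All manifolds ($X$, $M$ and the Lie group $G$) are finite-dimensional compact smooth manifolds without boundary and all maps are smooth; functions, vector fields, differential forms are complex-valued (complexified). $(X,\pi,M,G)$ is a smooth principal bundle with right action $(x,g)\mapsto xg$. $\Lambda^1(X)$ is the $C^\infty(X)$-module of 1-forms; $\Lambda^1_{\mathrm{hor}}(X)$ is the submodule of horizontal forms (vanishing on vertical vectors, i.e. vectors in $\ker T\pi$). The translation map $\check\tau:X\times_MX\to G$ is determined by $x\check\tau(x,y)=y$. Put $R_g:X\to X$, $x\mapsto xg$; $R_x:G\to X$, $g\mapsto xg$; $R_{\check x}:\pi^{-1}(\pi(x))\to G$, $y\mapsto\check\tau(x,y)$; $\mathrm{Ad}^G_g(g')=gg'g^{-1}$; $e\in G$ is the neutral element. (The vector $\mathrm{ver}^\Pi Y_x$ is vertical, hence acts on functions on the fibre through $x$.) Connections: $\mathcal{P}(X)$ is the set of $C^\infty(X)$-linear idempotent maps $\Pi:\Lambda^1(X)\to\Lambda^1(X)$ with $\ker\Pi=\Lambda^1_{\mathrm{hor}}(X)$ and $\Pi\circ R_g^*=R_g^*\circ\Pi$ for all $g\in G$. Connection forms: $\mathcal{F}(X)$ is the set of linear maps $\omega:C^\infty(G)\to\Lambda^1(X)$ such that (i) $\omega(h_1h_2)=\omega(h_1)h_2(e)+h_1(e)\omega(h_2)$ for all $h_1,h_2\in C^\infty(G)$; (ii) $\mathrm{ev}_e\circ R_x^*\circ\omega=\mathrm{ev}_e\circ\mathrm{d}$ for all $x\in X$, where $\mathrm{ev}_e$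 sends a 1-form on $G$ to its value at $e$; (iii) $R_g^*\circ\omega=\omega\circ(\mathrm{Ad}^G_{g^{-1}})^*$ for all $g\in G$. Exterior covariant differentiations: $\mathcal{D}(X)$ is the set of linear maps $D:C^\infty(X)\to\Lambda^1_{\mathrm{hor}}(X)$ such that (i) $D(fg)=D(f)g+fD(g)$ for all $f,g\in C^\infty(X)$; (ii) $\mathrm{d}b=Db$ for all $b\in\pi^*(C^\infty(M))$; (iii) $R_g^*\circ D=D\circ R_g^*$ for all $g\in G$. Each of these sets carries the affine structure it has as an affine subspace of the corresponding vector space of linear maps. A gauge transformation is a $G$-equivariant diffeomorphism $\gamma:X\to X$ that is vertical, i.e. $\pi\circ\gamma=\pi$; $\mathcal{G}(X)$ is the group of these under composition. The formula for $\Pi^D$ is given on exact forms and extended $C^\infty(X)$-linearly (every 1-form is a finite $C^\infty(X)$-linear combination of exact ones). *)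

(* Defs.v *)
From HB Require Import structures.
From mathcomp Require Import all_boot all_order all_algebra.
From mathcomp Require Import complex ring.
From mathcomp Require Import boolp classical_sets functions reals topology normedtype landau derive.
Set Implicit Arguments.
Unset Strict Implicit.
Unset Printing Implicit Defensive.
Import Order.TTheory GRing.Theory Num.Theory numFieldNormedType.Exports.
Local Open Scope classical_set_scope.
Local Open Scope ring_scope.

(* f is of class C^k at every point of U; only used for open U. *)
Fixpoint Ck (R : realType) n (k : nat) (U : set 'rV[R]_n) (f : 'rV[R]_n -> R) : Prop :=
  if k is k'.+1 then
    (forall x, U x -> differentiable f x) /\ (forall v, Ck k' U ('D_v f))
  else forall x, U x -> {for x, continuous f}.

Definition smooth_real (R : realType) n (U : set 'rV[R]_n) (f : 'rV[R]_n -> R) :=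
  forall k, Ck k U f.

Section Calc.
Variable R : realType.

Lemma near_eq_diff (V W : normedModType R) (f g : V -> W) x :
  (\near x, f x = g x) -> differentiable f x -> differentiable g x.
Proof.
move=> fg df.
have fgx : f x = g x by exact: nbhs_singleton fg.
have [dfc dfe] := (diff_locallyP x f).1 df.
have E : g \o shift x = cst (g x) + 'd f x +o_ 0 id.
  apply/eqaddoP => e e0.
  have /eqaddoP/(_ _ e0) H := dfe.
  have K : \forall z \near 0, f (z + x) = g (z + x).
    have := near_shift 0 x (fun z => f z = g z); rewrite /= subr0 => <-; exact: fg.
  apply: filterS2 H K => y + fgy.
  rewrite -[(_ - _) y]/(f (y + x) - (f x + 'd f x y)).
  by rewrite -[(g \o shift x - _) y]/(g (y + x) - (g x + 'd f x y)) fgy fgx.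
have D := diff_unique dfc E.
by apply/diff_locallyP; rewrite D.
Qed.

Lemma CkS n k (U : set 'rV[R]_n) f : Ck k.+1 U f -> Ck k U f.
Proof.
elim: k f => [|k IH] f [df Df].
  by move=> x Ux; apply: differentiable_continuous; exact: df.
by split=> // v; apply: IH; exact: Df.
Qed.

Lemma Ck_local n k (U : set 'rV[R]_n) f :
  (forall x, U x -> exists2 N, N x & Ck k N f) -> Ck k U f.
Proof.
elim: k f => [|k IH] f H.
  by move=> x /H[N Nx]; apply.
split=> [x /H[N Nx [df _]]|v]; first exact: df.
by apply: IH => x /H[N Nx [_ Df]]; exists N; [|exact: Df].
Qed.

Lemma Ck_sub n k (U V : set 'rV[R]_n) f : U `<=` V -> Ck k V f -> Ck k U f.
Proof. by move=> UV Vf; apply: Ck_local => x /UV Vx; exists V. Qed.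

Lemma Ck_eq n k (U : set 'rV[R]_n) f g : open U ->
  (forall x, U x -> f x = g x) -> Ck k U f -> Ck k U g.
Proof.
move=> oU; elim: k f g => [|k IH] f g fg.
  move=> fc x Ux; have N : nbhs x U by exact: open_nbhs_nbhs.
  have H : f @ x --> f x := fc x Ux.
  suff : g @ x --> g x by []; rewrite -(fg x Ux) => A /H fA.
  have fA' : nbhs x (f @^-1` A) := fA.
  suff : nbhs x (g @^-1` A) by [].
  by apply: filterS2 fA' N => y + Uy; rewrite /= (fg y Uy).
case=> df Df; have nfg x : U x -> \near x, f x = g x.
  by move=> Ux; apply: filterS (open_nbhs_nbhs (conj oU Ux)) => y /fg.
split=> [x Ux|v]; first by apply: near_eq_diff (df x Ux); exact: nfg.
by apply: IH (Df v) => x Ux; apply: near_eq_derive; exact: nfg.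
Qed.

Lemma Ck_cst n k (U : set 'rV[R]_n) a : Ck k U (cst a).
Proof.
elim: k a => [|k IH] a; first by move=> x _; exact: cst_continuous.
split=> [x _|v]; first exact: differentiable_cst.
have -> : 'D_v (cst a : 'rV[R]_n -> R) = cst 0.
  by apply/funext => x; exact: derive_cst.
exact: IH.
Qed.

Lemma CkD n k (U : set 'rV[R]_n) f g : open U ->
  Ck k U f -> Ck k U g -> Ck k U (f \+ g).
Proof.
move=> oU; elim: k f g => [|k IH] f g.
  by move=> fc gc x Ux; apply: continuousD; [exact: fc|exact: gc].
case=> df Df [dg Dg]; split=> [x Ux|v].
  by apply: differentiableD; [exact: df|exact: dg].
apply: (@Ck_eq _ _ _ ('D_v f \+ 'D_v g)) => //; last by apply: IH; [exact: Df|exact: Dg].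
move=> x Ux; rewrite deriveD //.
  by apply: diff_derivable; exact: df.
by apply: diff_derivable; exact: dg.
Qed.

Lemma CkM n k (U : set 'rV[R]_n) f g : open U ->
  Ck k U f -> Ck k U g -> Ck k U (f \* g).
Proof.
move=> oU; elim: k f g => [|k IH] f g.
  by move=> fc gc x Ux; apply: continuousM; [exact: fc|exact: gc].
move=> Cf Cg; have [df Df] := Cf; have [dg Dg] := Cg; split=> [x Ux|v].
  by apply: differentiableM; [exact: df|exact: dg].
apply: (@Ck_eq _ _ _ ((f \* 'D_v g) \+ (g \* 'D_v f))) => //.
  move=> x Ux; rewrite deriveM //.
    by apply: diff_derivable; exact: df.
  by apply: diff_derivable; exact: dg.
by apply: CkD => //; apply: IH => //; (exact: CkS) || (exact: Df) || exact: Dg.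
Qed.

Lemma Ck_sum n k (U : set 'rV[R]_n) (I : Type) (r : seq I) f : open U ->
  (forall i, Ck k U (f i)) -> Ck k U (fun x => \sum_(i <- r) f i x).
Proof.
move=> oU Cf; elim: r => [|i r IH].
  by under eq_fun do rewrite big_nil; exact: Ck_cst.
by under eq_fun do rewrite big_cons; exact: CkD.
Qed.

Lemma Ck_coord n k (U : set 'rV[R]_n) j : open U -> Ck k U (fun u => u 0 j).
Proof.
move=> oU; case: k => [|k]; first by move=> x _; exact: coord_continuous.
split=> [x _|v]; first exact: differentiable_coord.
have -> : 'D_v (fun u : 'rV[R]_n => u 0 j) = cst (v 0 j); last exact: Ck_cst.
apply/funext => x; rewrite deriveE; last exact: differentiable_coord.
have @f : {linear 'rV[R]_n -> R}.
  by exists (fun N : 'rV[R]_n => N 0 j); do 2![eexists]; do ?[constructor];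
     rewrite ?mxE// => ? *; rewrite ?mxE//; move=> ?; rewrite !mxE.
rewrite (_ : (fun _ => _) = f) // diff_lin //; exact/coord_continuous.
Qed.

Lemma rV_sum_coord n m (g : 'rV[R]_n -> 'rV[R]_m) :
  g = \sum_(j < m) (fun x => g x 0 j *: delta_mx 0 j).
Proof.
apply/funext => x; rewrite fct_sumE [LHS]row_sum_delta //.
Qed.

Lemma diff_rV n m (g : 'rV[R]_n -> 'rV[R]_m) x :
  (forall j, differentiable (fun u => g u 0 j) x) -> differentiable g x.
Proof.
move=> dg; rewrite (rV_sum_coord g); apply: differentiable_sum => j.
exact: differentiableZl.
Qed.

Lemma derive_coord n m (g : 'rV[R]_n -> 'rV[R]_m) x v j :
  (forall j, differentiable (fun u => g u 0 j) x) ->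
  'D_v g x 0 j = 'D_v (fun u => g u 0 j) x.
Proof.
move=> dg; rewrite !deriveE //; last exact: diff_rV.
have @f : {linear 'rV[R]_m -> R}.
  by exists (fun N : 'rV[R]_m => N 0 j); do 2![eexists]; do ?[constructor];
     rewrite ?mxE// => ? *; rewrite ?mxE//; move=> ?; rewrite !mxE.
have fc : continuous f by exact: coord_continuous.
have dG := diff_rV dg; have df : differentiable f (g x) by exact: linear_differentiable.
have := diff_comp dG df; rewrite (diff_lin _ fc) (_ : (fun u => g u 0 j) = f \o g) // => ->. done.
Qed.

Lemma derive_comp n m (g : 'rV[R]_n -> 'rV[R]_m) (f : 'rV[R]_m -> R) x v :
  (forall j, differentiable (fun u => g u 0 j) x) -> differentiable f (g x) ->
  'D_v (f \o g) x =
  \sum_(j < m) 'D_v (fun u => g u 0 j) x * 'D_(delta_mx 0 j) f (g x).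
Proof.
move=> dg df; have dG := diff_rV dg.
have E : 'D_v (f \o g) x = 'd f (g x) ('D_v g x).
  by rewrite !deriveE ?(diff_comp dG df) //; exact: differentiable_comp.
rewrite E [X in 'd f _ X]row_sum_delta linear_sum.
by apply: eq_bigr => j _; rewrite linearZ /= -derive_coord // (deriveE _ df).
Qed.

Lemma cont_rV (T : topologicalType) m (g : T -> 'rV[R]_m) x :
  (forall j, {for x, continuous (fun u => g u 0 j)}) -> {for x, continuous g}.
Proof.
move=> gc A [P P1 P2].
have H : nbhs x [set u | forall j, P 0 j (g u 0 j)].
  apply: (@filter_forall _ _ (fun j u => P 0 j (g u 0 j)) (nbhs x)) => j.
  by have := gc j (P 0 j) (P1 0 j); exact.
suff : nbhs x (g @^-1` A) by [].
by apply: filterS H => u Pu; apply: P2 => i j; rewrite (ord1 i).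
Qed.

Lemma Ck_comp n m k (U : set 'rV[R]_n) (V : set 'rV[R]_m)
    (g : 'rV[R]_n -> 'rV[R]_m) f :
  open U -> (forall x, U x -> V (g x)) ->
  (forall j, Ck k U (fun u => g u 0 j)) -> Ck k V f -> Ck k U (f \o g).
Proof.
move=> oU UV; elim: k f => [|k IH] f.
  move=> gc fc x Ux; apply: continuous_comp; last exact/fc/UV.
  by apply: cont_rV => j; exact: gc.
move=> Cg [df Df].
have dg x j : U x -> differentiable (fun u => g u 0 j) x.
  by move=> Ux; case: (Cg j) => + _; apply.
split=> [x Ux|v].
  apply: differentiable_comp; last exact/df/UV.
  by apply: diff_rV => j; exact: dg.
apply: (@Ck_eq _ _ _ (fun x => \sum_(j < m)
    'D_v (fun u => g u 0 j) x * 'D_(delta_mx 0 j) f (g x))) => //.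
  move=> x Ux; rewrite derive_comp //; last exact/df/UV.
  by move=> j; exact: dg.
apply: Ck_sum => // j; apply: CkM => //.
  by case: (Cg j) => _; exact.
by apply: (IH ('D_(delta_mx 0 j) f)) => [i|]; [exact: CkS|exact: Df].
Qed.
End Calc.

Record chart (R : realType) (X : topologicalType) (n : nat) := Chart {
  chart_dom : set X;
  chart_map :> X -> 'rV[R]_n;
  chart_inv : 'rV[R]_n -> X;
  chart_dom_open : open chart_dom;
  chart_cod_open : open (chart_map @` chart_dom);
  chart_mapK : forall x, chart_dom x -> chart_inv (chart_map x) = x;
  chart_map_continuous : forall x, chart_dom x -> {for x, continuous chart_map};
  chart_inv_continuous :
    forall u, (chart_map @` chart_dom) u -> {for u, continuous chart_inv} }.

(* Compact manifolds without boundary, of pure dimension. Second countability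
   follows from compactness; an atlas need not be maximal. A space may be
   empty, the atlas then being empty too. *)
Record manifold (R : realType) := Manifold {
  mspace :> topologicalType;
  mdim : nat;
  atlas : set (chart R mspace mdim);
  atlas_cover : forall x, exists2 c, atlas c & chart_dom c x;
  atlas_compat : forall c d, atlas c -> atlas d -> forall j,
    smooth_real (c @` (chart_dom c `&` chart_dom d))
      (fun u => d (chart_inv c u) 0 j);
  mhausdorff : hausdorff_space mspace;
  mcompact : compact [set: mspace] }.

Definition smooth_fun_on (R : realType) (X : manifold R) (U : set X)
    (f : X -> R) : Prop :=
  forall c, atlas c ->
    smooth_real (c @` (chart_dom c `&` U)) (f \o chart_inv c).

(* For open U; the components of f are read in the charts of Y. *)
Definition smooth_map_on (R : realType) (X Y : manifold R) (U : set X)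
    (f : X -> Y) : Prop :=
  (forall x, U x -> {for x, continuous f}) /\
  (forall d, atlas d -> forall j,
     smooth_fun_on (U `&` f @^-1` chart_dom d) (fun x => d (f x) 0 j)).

Section Manifold_theory.
Variable R : realType.

Lemma chart_img_open (X : topologicalType) n (c : chart R X n) (A : set X) :
  open A -> open (c @` (chart_dom c `&` A)).
Proof.
move=> oA; rewrite openE => _ [x [cx Ax] <-]; rewrite /interior.
have cu : (c @` chart_dom c) (c x) by exists x.
have N1 : nbhs (c x) (c @` chart_dom c).
  by apply: open_nbhs_nbhs; split => //; exact: chart_cod_open.
have N2 : nbhs (c x) (chart_inv c @^-1` A).
  apply: (chart_inv_continuous cu); rewrite chart_mapK //.
  by apply: open_nbhs_nbhs; split.
apply: filterS2 N1 N2 => _ [y cy <-] /=; rewrite chart_mapK // => Ay.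
by exists y.
Qed.

Lemma open_preim (X Y : topologicalType) (f : X -> Y) (U : set X) (A : set Y) :
  open U -> open A -> (forall x, U x -> {for x, continuous f}) ->
  open (U `&` f @^-1` A).
Proof.
move=> oU oA fc; rewrite openE => x [Ux Ax]; rewrite /interior.
apply: filterI; first by apply: open_nbhs_nbhs.
by apply: (fc x Ux); apply: open_nbhs_nbhs.
Qed.

Lemma smooth_fun_local (X : manifold R) (U : set X) f :
  (forall x, U x -> exists2 N, N x & smooth_fun_on N f) -> smooth_fun_on U f.
Proof.
move=> H c Ac k; apply: Ck_local => _ [x [cx Ux] <-].
have [N Nx sN] := H x Ux.
by exists (c @` (chart_dom c `&` N)); [exists x|exact: sN].
Qed.

Lemma smooth_fun_sub (X : manifold R) (U V : set X) f :
  U `<=` V -> smooth_fun_on V f -> smooth_fun_on U f.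
Proof. by move=> UV sV; apply: smooth_fun_local => x /UV Vx; exists V. Qed.

Lemma smooth_fun_cst (X : manifold R) (U : set X) a : smooth_fun_on U (cst a).
Proof. by move=> c Ac k; exact: Ck_cst. Qed.

Lemma smooth_funD (X : manifold R) (U : set X) f g : open U ->
  smooth_fun_on U f -> smooth_fun_on U g -> smooth_fun_on U (f \+ g).
Proof.
move=> oU sf sg c Ac k.
by apply: CkD; [exact: chart_img_open|exact: sf|exact: sg].
Qed.

Lemma smooth_funM (X : manifold R) (U : set X) f g : open U ->
  smooth_fun_on U f -> smooth_fun_on U g -> smooth_fun_on U (f \* g).
Proof.
move=> oU sf sg c Ac k.
by apply: CkM; [exact: chart_img_open|exact: sf|exact: sg].
Qed.

Lemma smooth_funN (X : manifold R) (U : set X) f : open U ->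
  smooth_fun_on U f -> smooth_fun_on U (fun x => - f x).
Proof.
move=> oU sf; rewrite (_ : (fun x => _) = cst (-1) \* f).
  by apply: smooth_funM => //; exact: smooth_fun_cst.
by apply/funext => x /=; rewrite mulN1r.
Qed.

Lemma smooth_fun_chart (X : manifold R) (c : chart R X (mdim X)) j :
  atlas c -> smooth_fun_on (chart_dom c) (fun x => c x 0 j).
Proof. by move=> Ac d Ad; exact: atlas_compat. Qed.

Lemma smooth_fun_comp (X Y : manifold R) (U : set X) (W : set Y)
    (f : X -> Y) (g : Y -> R) :
  open U -> open W -> smooth_map_on U f -> smooth_fun_on W g ->
  smooth_fun_on (U `&` f @^-1` W) (g \o f).
Proof.
move=> oU oW [fc sf] sg; apply: smooth_fun_local => x [Ux Wx].
have [d Ad dfx] := atlas_cover (f x).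
exists (U `&` f @^-1` (chart_dom d `&` W)) => // c Ac k.
have oN : open (U `&` f @^-1` (chart_dom d `&` W)).
  by apply: open_preim => //; apply: openI => //; exact: chart_dom_open.
have oI := @chart_img_open _ _ c _ oN.
apply: (@Ck_eq _ _ _ _ ((g \o chart_inv d) \o (fun u => d (f (chart_inv c u))))) => //.
  move=> _ [y [cy [Uy [dy Wy]]] <-] /=.
  by rewrite [chart_inv c _]chart_mapK // chart_mapK.
apply: (@Ck_comp _ _ _ _ _ (d @` (chart_dom d `&` W))) => //.
- by move=> _ [y [cy [Uy Dy]] <-] /=; exists (f y); rewrite ?chart_mapK.
- move=> j; apply: Ck_sub (sf d Ad j c Ac k).
  by move=> _ [y [cy [Uy [dy Wy]]] <-]; exists y.
- exact: sg.
Qed.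

Lemma smooth_map_comp (X Y Z : manifold R) (U : set X) (V : set Y)
    (f : X -> Y) (g : Y -> Z) :
  open U -> open V -> (forall x, U x -> V (f x)) ->
  smooth_map_on U f -> smooth_map_on V g -> smooth_map_on U (g \o f).
Proof.
move=> oU oV UV [fc sf] [gc sg]; split.
  by move=> x Ux; apply: continuous_comp; [exact: fc|apply/gc/UV].
move=> e Ae j.
have oW : open (V `&` g @^-1` chart_dom e).
  by apply: open_preim => //; exact: chart_dom_open.
have := smooth_fun_comp oU oW (conj fc sf) (sg e Ae j).
by apply: smooth_fun_sub => x [Ux ex]; split=> //; split=> //; exact: UV.
Qed.

Lemma smooth_map_id (X : manifold R) : smooth_map_on [set: X] id.
Proof.
split; first by move=> x _; exact: cvg_id.
move=> d Ad j; apply: smooth_fun_sub (smooth_fun_chart j Ad).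
by move=> x [].
Qed.

Lemma smooth_map_cst (X Y : manifold R) (y : Y) :
  smooth_map_on [set: X] (cst y).
Proof.
by split=> [x _|d Ad j]; [exact: cst_continuous|exact: (@smooth_fun_cst X _ (d y 0 j))].
Qed.
End Manifold_theory.

Section Product_chart.
Variables (R : realType) (X Y : topologicalType) (m n : nat).
Variables (c : chart R X m) (d : chart R Y n).

Let dom : set (X * Y) := chart_dom c `*` chart_dom d.
Let map (p : X * Y) : 'rV[R]_(m + n) := row_mx (c p.1) (d p.2).
Let inv (u : 'rV[R]_(m + n)) := (chart_inv c (lsubmx u), chart_inv d (rsubmx u)).

Let cod : map @` dom = lsubmx @^-1` (c @` chart_dom c) `&` rsubmx @^-1` (d @` chart_dom d).
Proof.
apply/seteqP; split=> [_ [[x y] [/= cx dy] <-]|u [[x cx xu] [y dy yu]]].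
  by split; rewrite /= /map ?row_mxKl ?row_mxKr; [exists x|exists y].
by exists (x, y); rewrite // /map /= xu yu hsubmxK.
Qed.

Fact prod_chart_dom_open : open dom.
Proof.
rewrite openE => -[x y] [/= cx dy]; rewrite /interior.
by exists (chart_dom c, chart_dom d) => //; split; apply: open_nbhs_nbhs;
  split => //; exact: chart_dom_open.
Qed.

Fact prod_chart_cod_open : open (map @` dom).
Proof.
rewrite cod; apply: openI; (apply: open_comp; last exact: chart_cod_open).
  by move=> u _; exact: continuous_lsubmx.
by move=> u _; exact: continuous_rsubmx.
Qed.

Fact prod_chart_mapK p : dom p -> inv (map p) = p.
Proof.
by case: p => x y [/= cx dy]; rewrite /inv row_mxKl row_mxKr !chart_mapK.
Qed.

Fact prod_chart_map_continuous p : dom p -> {for p, continuous map}.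
Proof.
case: p => x y [/= cx dy]; apply: cont_rV => j.
rewrite -(splitK j) /map; case: (fintype.split j) => i /=.
  suff : continuous_at (x, y) (fun p : X * Y => c p.1 0 i).
    rewrite (_ : (fun p : X * Y => _) = (fun p : X * Y =>
      row_mx (c p.1) (d p.2) 0 (lshift n i))) //.
    by apply/funext => p; rewrite row_mxEl.
  apply: (@continuous_comp _ _ _ fst (fun x => c x 0 i)); first exact: cvg_fst.
  apply: (@continuous_comp _ _ _ c (fun v => v 0 i)); last exact: coord_continuous.
  exact: chart_map_continuous.
suff : continuous_at (x, y) (fun p : X * Y => d p.2 0 i).
  rewrite (_ : (fun p : X * Y => _) = (fun p : X * Y =>
    row_mx (c p.1) (d p.2) 0 (rshift m i))) //.
  by apply/funext => p; rewrite row_mxEr.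
apply: (@continuous_comp _ _ _ snd (fun x => d x 0 i)); first exact: cvg_snd.
apply: (@continuous_comp _ _ _ d (fun v => v 0 i)); last exact: coord_continuous.
exact: chart_map_continuous.
Qed.

Fact prod_chart_inv_continuous u : (map @` dom) u -> {for u, continuous inv}.
Proof.
rewrite cod => -[/= cu du].
have Hc : {for u, continuous (chart_inv c \o lsubmx)}.
  apply: continuous_comp; first exact: continuous_lsubmx.
  exact: chart_inv_continuous.
have Hd : {for u, continuous (chart_inv d \o rsubmx)}.
  apply: continuous_comp; first exact: continuous_rsubmx.
  exact: chart_inv_continuous.
exact: (cvg_pair Hc Hd).
Qed.

Definition prod_chart : chart R (X * Y)%type (m + n) :=
  Chart prod_chart_dom_open prod_chart_cod_open prod_chart_mapK
    prod_chart_map_continuous prod_chart_inv_continuous.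
End Product_chart.

Section Product_manifold.
Variables (R : realType) (X Y : manifold R).

Let patlas : set (chart R (X * Y)%type (mdim X + mdim Y)) :=
  [set e | exists c d, [/\ atlas c, atlas d & e = prod_chart c d]].

Fact prod_atlas_cover p : exists2 e, patlas e & chart_dom e p.
Proof.
have [c Ac cp] := atlas_cover p.1; have [d Ad dp] := atlas_cover p.2.
by exists (prod_chart c d) => //; exists c, d.
Qed.

Fact prod_atlas_compat e e' : patlas e -> patlas e' -> forall j,
  smooth_real (e @` (chart_dom e `&` chart_dom e'))
    (fun u => e' (chart_inv e u) 0 j).
Proof.
move=> [c [d [Ac Ad ->]]] [c' [d' [Ac' Ad' ->]]] j k.
have oI : open (prod_chart c d @` (chart_dom (prod_chart c d) `&`
                                   chart_dom (prod_chart c' d'))).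
  by apply: chart_img_open; exact: prod_chart_dom_open.
rewrite -(splitK j); case: (fintype.split j) => i /=.
  apply: (@Ck_eq _ _ _ _
    ((fun v => c' (chart_inv c v) 0 i) \o (fun u => lsubmx u))) => //.
    by move=> u _ /=; rewrite row_mxEl.
  apply: (@Ck_comp _ _ _ _ _ (c @` (chart_dom c `&` chart_dom c'))) => //.
  - move=> _ [[x y] [[/= cx dy] [/= cx' dy']] <-].
    by exists x => //=; rewrite row_mxKl.
  - move=> l; apply: (@Ck_eq _ _ _ _ (fun u => u 0 (lshift _ l))) => //.
      by move=> u _; rewrite mxE.
    exact: Ck_coord.
  - exact: atlas_compat.
apply: (@Ck_eq _ _ _ _
  ((fun v => d' (chart_inv d v) 0 i) \o (fun u => rsubmx u))) => //.
  by move=> u _ /=; rewrite row_mxEr.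
apply: (@Ck_comp _ _ _ _ _ (d @` (chart_dom d `&` chart_dom d'))) => //.
- move=> _ [[x y] [[/= cx dy] [/= cx' dy']] <-].
  by exists y => //=; rewrite row_mxKr.
- move=> l; apply: (@Ck_eq _ _ _ _ (fun u => u 0 (rshift _ l))) => //.
    by move=> u _; rewrite mxE.
  exact: Ck_coord.
- exact: atlas_compat.
Qed.

Fact prod_hausdorff : hausdorff_space (X * Y)%type.
Proof.
move=> [x y] [x' y'] cl; congr (_, _).
- apply: mhausdorff => A B Ax Bx.
  have [||[z t] [/= Az Bz]] := cl (fst @^-1` A) (fst @^-1` B).
  + exact: (@cvg_fst _ _ (nbhs x) (nbhs y)).
  + exact: (@cvg_fst _ _ (nbhs x') (nbhs y')).
  by exists z.
- apply: mhausdorff => A B Ax Bx.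
  have [||[z t] [/= Az Bz]] := cl (snd @^-1` A) (snd @^-1` B).
  + exact: (@cvg_snd _ _ (nbhs x) (nbhs y)).
  + exact: (@cvg_snd _ _ (nbhs x') (nbhs y')).
  by exists t.
Qed.

Fact prod_compact : compact [set: (X * Y)%type].
Proof. by rewrite -setXTT; apply: compact_setX; exact: mcompact. Qed.

Definition prod_manifold : manifold R :=
  Manifold prod_atlas_cover prod_atlas_compat prod_hausdorff prod_compact.

End Product_manifold.

Record smap (R : realType) (X Y : manifold R) := Smap {
  smap_fun :> X -> Y;
  smapP : smooth_map_on setT smap_fun }.

Section Smaps.
Variable R : realType.
Implicit Types X Y Z : manifold R.

Definition smap_id X : smap X X := Smap (@smooth_map_id R X).

Definition smap_cst X Y (y : Y) : smap X Y := Smap (@smooth_map_cst R X Y y).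

Fact smap_comp_subproof X Y Z (g : smap Y Z) (f : smap X Y) :
  smooth_map_on setT (g \o f).
Proof.
by apply: (smooth_map_comp openT openT) => //; exact: smapP.
Qed.
Definition smap_comp X Y Z (g : smap Y Z) (f : smap X Y) : smap X Z :=
  Smap (smap_comp_subproof g f).

Fact smap_pair_subproof X Y Z (f : smap X Y) (g : smap X Z) :
  smooth_map_on (Y := prod_manifold Y Z) setT (fun x => (f x, g x)).
Proof.
split=> [x _|e [c [d [Ac Ad ->]]] j].
  have fx := (smapP f).1 x I; have gx := (smapP g).1 x I.
  exact: (cvg_pair fx gx).
rewrite -(splitK j); case: (fintype.split j) => i /=.
  rewrite (_ : (fun x => _) = (fun x => c (f x) 0 i)); last first.
    by apply/funext => x; exact: row_mxEl.
  by apply: smooth_fun_sub ((smapP f).2 c Ac i) => x [_ [/= ? ?]].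
rewrite (_ : (fun x => _) = (fun x => d (g x) 0 i)); last first.
  by apply/funext => x; exact: row_mxEr.
by apply: smooth_fun_sub ((smapP g).2 d Ad i) => x [_ [/= ? ?]].
Qed.
Definition smap_pair X Y Z (f : smap X Y) (g : smap X Z) :
  smap X (prod_manifold Y Z) := Smap (smap_pair_subproof f g).
End Smaps.

(* Complex-valued smooth functions. *)
Definition smooth_cfun (R : realType) (X : manifold R) (f : X -> R[i]) : Prop :=
  smooth_fun_on setT (fun x => complex.Re (f x)) /\
  smooth_fun_on setT (fun x => complex.Im (f x)).

(* The ring of complex-valued smooth functions on X; complex scalars act
   through the constant functions cinf_cst. *)
Record cinf (R : realType) (X : manifold R) := Cinf {
  cinf_fun :> X -> R[i];
  _ : cinf_fun \in [pred f | `[< smooth_cfun f >]] }.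

Section Cinf_ring.
Variables (R : realType) (X : manifold R).

Definition cinf_pred : {pred X -> R[i]} := [pred f | `[< smooth_cfun f >]].

HB.instance Definition _ := [isSub of cinf X for @cinf_fun R X].
HB.instance Definition _ := [Choice of cinf X by <:].

Fact cinf_subring_closed : subring_closed cinf_pred.
Proof.
split.
- by apply/asboolP; split; exact: smooth_fun_cst.
- move=> f g /asboolP[f1 f2] /asboolP[g1 g2]; apply/asboolP.
  have oT := @openT X; split.
  + have := smooth_funD oT f1 (smooth_funN oT g1).
    congr smooth_fun_on; apply/funext => x; rewrite -[(f - g) x]/(f x - g x).
    by rewrite /=; case: (f x) => a b; case: (g x).
  + have := smooth_funD oT f2 (smooth_funN oT g2).
    congr smooth_fun_on; apply/funext => x; rewrite -[(f - g) x]/(f x - g x).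
    by rewrite /=; case: (f x) => a b; case: (g x).
- move=> f g /asboolP[f1 f2] /asboolP[g1 g2]; apply/asboolP.
  have oT := @openT X; split.
  + have := smooth_funD oT (smooth_funM oT f1 g1) (smooth_funN oT (smooth_funM oT f2 g2)).
    congr smooth_fun_on; apply/funext => x; rewrite -[(f * g) x]/(f x * g x).
    by rewrite /=; case: (f x) => a b; case: (g x).
  + have := smooth_funD oT (smooth_funM oT f1 g2) (smooth_funM oT f2 g1).
    congr smooth_fun_on; apply/funext => x; rewrite -[(f * g) x]/(f x * g x).
    by rewrite /=; case: (f x) => a b; case: (g x).
Qed.

HB.instance Definition _ :=
  GRing.SubChoice_isSubComPzRing.Build _ _ (cinf X) cinf_subring_closed.

Definition to_cinf (f : X -> R[i]) (sf : smooth_cfun f) : cinf X :=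
  Cinf (asboolT sf : f \in cinf_pred).

Lemma cinfP (f : cinf X) : smooth_cfun f.
Proof. by apply/asboolP; exact: (valP f). Qed.

Lemma cinf_ext (f g : cinf X) : f =1 g -> f = g.
Proof. by move=> fg; apply: val_inj; exact/funext. Qed.

Fact cst_smooth_cfun (a : R[i]) : smooth_cfun (fun _ : X => a).
Proof. by split; exact: smooth_fun_cst. Qed.
Definition cinf_cst (a : R[i]) : cinf X := to_cinf (cst_smooth_cfun a).
End Cinf_ring.

Section Pull_fun.
Variables (R : realType) (X Y : manifold R).

Lemma smooth_cfun_comp (f : smap X Y) (h : Y -> R[i]) :
  smooth_cfun h -> smooth_cfun (h \o f).
Proof.
move=> [h1 h2]; have sf := smapP f; split.
  have := smooth_fun_comp openT openT sf h1; exact: smooth_fun_sub.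
have := smooth_fun_comp openT openT sf h2; exact: smooth_fun_sub.
Qed.

Definition pull_fun (f : smap X Y) (h : cinf Y) : cinf X :=
  to_cinf (smooth_cfun_comp f (cinfP h)).
End Pull_fun.

(* Complexified tangent vectors at x are the complex-linear derivations at x
   of the algebra of complex-valued smooth functions. *)
Section Tangent.
Variables (R : realType) (X : manifold R).

Definition derivation_at (x : X) (v : cinf X -> R[i]) : Prop :=
  (forall a f g, v (cinf_cst X a * f + g) = a * v f + v g) /\
  (forall f g, v (f * g) = v f * g x + f x * v g).

Definition tangent_pred (x : X) : {pred cinf X -> R[i]^o} :=
  [pred v | `[< derivation_at x v >]].

Record tangent (x : X) := Tangent {
  tangent_fun :> cinf X -> R[i];
  _ : tangent_fun \in tangent_pred x }.

HB.instance Definition _ x := [isSub of tangent x for @tangent_fun x].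
HB.instance Definition _ x := [Choice of tangent x by <:].

Fact tangent_submod_closed x : submod_closed (tangent_pred x).
Proof.
split.
  apply/asboolP; have E f : (0 : cinf X -> R[i]^o) f = 0 by [].
  by split=> [a f g|f g]; rewrite !E ?mulr0 ?mul0r ?addr0.
move=> a u v /asboolP[u1 u2] /asboolP[v1 v2]; apply/asboolP.
have E f : (a *: u + v) f = a * u f + v f by [].
split=> [b f g|f g]; rewrite !E ?u1 ?v1 ?u2 ?v2; first by ring.
by ring.
Qed.
HB.instance Definition _ x :=
  GRing.SubChoice_isSubLmodule.Build _ _ _ (tangent x)
    (tangent_submod_closed x).
End Tangent.

Section Tangent_theory.
Variable R : realType.

Lemma tangentP (X : manifold R) (x : X) (v : tangent x) : derivation_at x v.
Proof. by apply/asboolP; exact: (valP v). Qed.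

Lemma tangent_ext (X : manifold R) (x : X) (u v : tangent x) : u =1 v -> u = v.
Proof. by move=> uv; apply: val_inj; exact/funext. Qed.

Definition to_tangent (X : manifold R) (x : X) (v : cinf X -> R[i])
    (dv : derivation_at x v) : tangent x :=
  Tangent (asboolT dv : (v : cinf X -> R[i]^o) \in tangent_pred x).

Fact tmap_subproof (X Y : manifold R) (f : smap X Y) x (v : tangent x) :
  derivation_at (f x) (fun h => v (pull_fun f h)).
Proof.
have [v1 v2] := tangentP v; split=> [a h k|h k].
  by rewrite -v1; congr (v _); exact: cinf_ext.
rewrite (_ : pull_fun f (h * k) = pull_fun f h * pull_fun f k) ?v2 //.
exact: cinf_ext.
Qed.
Definition tmap (X Y : manifold R) (f : smap X Y) x (v : tangent x) :
  tangent (f x) := to_tangent (tmap_subproof f v).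
End Tangent_theory.

Definition smooth_field (R : realType) (X : manifold R)
    (V : forall x : X, tangent x) : Prop :=
  forall f : cinf X, smooth_cfun (fun x => V x f).

(* A 1-form is a family of complex-linear functionals on the (complexified)
   tangent spaces whose values on smooth vector fields are smooth. *)
Record form (R : realType) (X : manifold R) := Form {
  form_fun :> forall x : X, tangent x -> R[i];
  form_linear : forall x, scalar (@form_fun x);
  form_smooth : forall V : forall x : X, tangent x,
    smooth_field V -> smooth_cfun (fun x => form_fun (V x)) }.
Arguments form_fun {R X} _ x _.

HB.instance Definition _ (R : realType) (X : manifold R) :=
  gen_eqMixin (form X).
HB.instance Definition _ (R : realType) (X : manifold R) :=
  gen_choiceMixin (form X).

Section Form_module.
Variables (R : realType) (X : manifold R).
Implicit Types (a b : form X) (f g : cinf X).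

Lemma form_ext a b : (forall x (v : tangent x), a x v = b x v) -> a = b.
Proof.
case: a b => [a la sa] [b lb sb] /= ab.
have E : a = b by apply: functional_extensionality_dep => x; exact/funext.
by case: _ / E in lb sb *; congr Form; exact: Prop_irrelevance.
Qed.

Fact form0_linear (x : X) : scalar (fun _ : tangent x => 0 : R[i]).
Proof. by move=> c u v; rewrite mulr0 addr0. Qed.
Fact form0_smooth (V : forall x : X, tangent x) :
  smooth_field V -> smooth_cfun (fun _ : X => 0 : R[i]).
Proof. by move=> _; exact: cst_smooth_cfun. Qed.
Definition form0 : form X := Form form0_linear form0_smooth.

Fact formD_linear a b x : scalar (fun v : tangent x => a x v + b x v).
Proof. by move=> c u v; rewrite !form_linear; ring. Qed.
Fact formD_smooth a b (V : forall x : X, tangent x) :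
  smooth_field V -> smooth_cfun (fun x => a x (V x) + b x (V x)).
Proof.
move=> sV; exact: (cinfP (to_cinf (form_smooth a sV) + to_cinf (form_smooth b sV))).
Qed.
Definition formD a b : form X := Form (formD_linear a b) (@formD_smooth a b).

Fact formZ_linear f a x : scalar (fun v : tangent x => f x * a x v).
Proof. by move=> c u v; rewrite !form_linear; ring. Qed.
Fact formZ_smooth f a (V : forall x : X, tangent x) :
  smooth_field V -> smooth_cfun (fun x => f x * a x (V x)).
Proof. by move=> sV; exact: (cinfP (f * to_cinf (form_smooth a sV))). Qed.
Definition formZ f a : form X := Form (formZ_linear f a) (@formZ_smooth f a).

Fact formN_linear a x : scalar (fun v : tangent x => - a x v).
Proof. by move=> c u v; rewrite !form_linear; ring. Qed.
Fact formN_smooth a (V : forall x : X, tangent x) :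
  smooth_field V -> smooth_cfun (fun x => - a x (V x)).
Proof. by move=> sV; exact: (cinfP (- to_cinf (form_smooth a sV))). Qed.
Definition formN a : form X := Form (formN_linear a) (@formN_smooth a).

Fact formDA : associative formD.
Proof. by move=> a b c; apply: form_ext => x v /=; rewrite addrA. Qed.
Fact formDC : commutative formD.
Proof. by move=> a b; apply: form_ext => x v /=; rewrite addrC. Qed.
Fact form0D : left_id form0 formD.
Proof. by move=> a; apply: form_ext => x v /=; rewrite add0r. Qed.
Fact formND : left_inverse form0 formN formD.
Proof. by move=> a; apply: form_ext => x v /=; rewrite addNr. Qed.
HB.instance Definition _ := GRing.isZmodule.Build (form X)
  formDA formDC form0D formND.

Fact formZA f g a : formZ f (formZ g a) = formZ (f * g) a.
Proof. by apply: form_ext => x v /=; rewrite mulrA. Qed.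
Fact form1Z : left_id 1 formZ.
Proof. by move=> a; apply: form_ext => x v /=; rewrite mul1r. Qed.
Fact formZDr : right_distributive formZ +%R.
Proof. by move=> f a b; apply: form_ext => x v /=; rewrite mulrDr. Qed.
Fact formZDl a : {morph formZ^~ a : f g / f + g}.
Proof. by move=> f g; apply: form_ext => x v /=; rewrite mulrDl. Qed.
HB.instance Definition _ := GRing.Zmodule_isLmodule.Build (cinf X) (form X)
  formZA form1Z formZDr formZDl.

Fact form_d_linear f x : scalar (fun v : tangent x => v f).
Proof. by []. Qed.
Fact form_d_smooth f (V : forall x : X, tangent x) :
  smooth_field V -> smooth_cfun (fun x => V x f).
Proof. exact. Qed.
Definition form_d f : form X := Form (form_d_linear f) (@form_d_smooth f).
End Form_module.

Record diffeo (R : realType) (X Y : manifold R) := Diffeo {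
  dfun :> smap X Y;
  dinv : smap Y X;
  dfunK : cancel dfun dinv;
  dinvK : cancel dinv dfun }.

Section Diffeo.
Variable R : realType.
Implicit Types X Y Z : manifold R.

Definition diffeo_id X : diffeo X X :=
  @Diffeo R X X (smap_id X) (smap_id X) (fun=> erefl) (fun=> erefl).

Definition diffeo_inv X Y (f : diffeo X Y) : diffeo Y X :=
  Diffeo (@dinvK _ _ _ f) (@dfunK _ _ _ f).

Definition diffeo_comp X Y Z (g : diffeo Y Z) (f : diffeo X Y) : diffeo X Z :=
  @Diffeo R X Z (smap_comp g f) (smap_comp (dinv f) (dinv g))
    (can_comp (@dfunK _ _ _ g) (@dfunK _ _ _ f))
    (can_comp (@dinvK _ _ _ f) (@dinvK _ _ _ g)).

Lemma smap_ext X Y (f g : smap X Y) : f =1 g -> f = g.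
Proof.
case: f g => [f sf] [g sg] /= /funext E.
by case: _ / E in sg *; congr Smap; exact: Prop_irrelevance.
Qed.

Lemma diffeo_ext X Y (f g : diffeo X Y) : f =1 g -> f = g.
Proof.
case: f g => [f fi fK fiK] [g gi gK giK] /= fg.
have E : f = g by exact: smap_ext.
have Ei : fi = gi by apply: smap_ext => y; rewrite -[y in LHS]giK -fg fK.
case: _ / E in gK giK fg *; case: _ / Ei in gK giK *.
by congr Diffeo; exact: Prop_irrelevance.
Qed.

Section Pull_form.
Variables (X Y : manifold R) (f : diffeo X Y) (a : form Y).

Fact pull_form_linear x : scalar (fun v : tangent x => a (f x) (tmap f v)).
Proof.
by move=> c u v; rewrite -form_linear; congr (a _ _); exact: tangent_ext.
Qed.

Fact pull_form_smooth (V : forall x : X, tangent x) : smooth_field V ->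
  smooth_cfun (fun x => a (f x) (tmap f (V x))).
Proof.
move=> sV.
have dW y : derivation_at y (fun h => V (dinv f y) (pull_fun f h)).
  by rewrite -[X in derivation_at X _](dinvK f); exact: tmap_subproof.
pose W y := to_tangent (dW y).
have sW : smooth_field W.
  by move=> h; exact: (smooth_cfun_comp (dinv f) (sV (pull_fun f h))).
have := smooth_cfun_comp f (form_smooth a sW).
congr smooth_cfun; apply/funext => x /=; congr (a _ _).
by apply: tangent_ext => h /=; rewrite dfunK.
Qed.

Definition pull_form : form X := Form pull_form_linear pull_form_smooth.
End Pull_form.
End Diffeo.

Record lie_group (R : realType) := LieGroup {
  lie_space :> manifold R;
  lie_one : lie_space;
  lie_mul : smap (prod_manifold lie_space lie_space) lie_space;
  lie_inv : smap lie_space lie_space;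
  lie_mulA : forall g h k,
    lie_mul (g, lie_mul (h, k)) = lie_mul (lie_mul (g, h), k);
  lie_mul1g : forall g, lie_mul (lie_one, g) = g;
  lie_mulg1 : forall g, lie_mul (g, lie_one) = g;
  lie_mulVg : forall g, lie_mul (lie_inv g, g) = lie_one;
  lie_mulgV : forall g, lie_mul (g, lie_inv g) = lie_one }.

Definition lie_Ad (R : realType) (G : lie_group R) (g : G) : smap G G :=
  smap_comp (lie_mul G)
    (smap_pair (smap_comp (lie_mul G) (smap_pair (smap_cst G g) (smap_id G)))
               (smap_cst G (lie_inv G g))).

Record principal_bundle (R : realType) (X M : manifold R) (G : lie_group R) :=
  PrincipalBundle {
  proj : smap X M;
  act : smap (prod_manifold X G) X;
  act1 : forall x, act (x, lie_one G) = x;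
  actM : forall x g h, act (act (x, g), h) = act (x, lie_mul G (g, h));
  proj_act : forall x g, proj (act (x, g)) = proj x;
  local_triviality : forall m : M, exists U : set M, [/\ open U, U m &
    exists (s : prod_manifold M G -> X) (t : X -> G),
      [/\ smooth_map_on (U `*` setT : set (prod_manifold M G)) s,
          smooth_map_on (proj @^-1` U) t,
          forall b g, U b -> proj (s (b, g)) = b /\ t (s (b, g)) = g,
          forall x, U (proj x) -> s (proj x, t x) = x &
          forall b g h, U b -> s (b, lie_mul G (g, h)) = act (s (b, g), h)]] }.

Section Bundle.
Variables (R : realType) (X M : manifold R) (G : lie_group R).
Variable P : principal_bundle X M G.

Definition Rg_smap (g : G) : smap X X :=
  smap_comp (act P) (smap_pair (smap_id X) (smap_cst X g)).

Fact RgK g : cancel (Rg_smap g) (Rg_smap (lie_inv G g)).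
Proof. by move=> x /=; rewrite actM lie_mulgV act1. Qed.
Fact RgVK g : cancel (Rg_smap (lie_inv G g)) (Rg_smap g).
Proof. by move=> x /=; rewrite actM lie_mulVg act1. Qed.

Definition Rg (g : G) : diffeo X X := Diffeo (RgK g) (RgVK g).

Definition Rx (x : X) : smap G X :=
  smap_comp (act P) (smap_pair (smap_cst G x) (smap_id G)).

(* Only meaningful when x and y lie in the same fibre; the default value
   lie_one is used otherwise. *)
Definition translation (x y : X) : G :=
  xget (lie_one G) [set g | act P (x, g) = y].

Definition vertical (x : X) (v : tangent x) : Prop := tmap (proj P) v = 0.

Definition horizontal (a : form X) : Prop :=
  forall x (v : tangent x), vertical v -> a x v = 0.

(* The sets below consist of maps into forms; linearity is part of membership,
   and affine combinations (affine_comb) are formed pointwise. *)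
Definition connections : set (form X -> form X) := [set Pi |
  [/\ linear Pi,
      forall a, Pi (Pi a) = Pi a,
      forall a, Pi a = 0 <-> horizontal a &
      forall g a, Pi (pull_form (Rg g) a) = pull_form (Rg g) (Pi a)]].

Definition clinear (Y : manifold R) (L : cinf Y -> form X) : Prop :=
  forall (c : R[i]) f g,
    L (cinf_cst Y c * f + g) = cinf_cst X c *: L f + L g.

Definition connection_forms : set (cinf G -> form X) := [set w |
  [/\ clinear w,
      forall h1 h2, w (h1 * h2) =
        cinf_cst X (h2 (lie_one G)) *: w h1 + cinf_cst X (h1 (lie_one G)) *: w h2,
      forall x h (v : tangent (lie_one G)),
        w h (Rx x (lie_one G)) (tmap (Rx x) v) = form_d h (lie_one G) v &
      forall g h, pull_form (Rg g) (w h) =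
        w (pull_fun (lie_Ad (lie_inv G g)) h)]].

Definition covariant_differentiations : set (cinf X -> form X) := [set D |
  [/\ clinear D /\ (forall f, horizontal (D f)),
      forall f g, D (f * g) = g *: D f + f *: D g,
      forall b : cinf M, form_d (pull_fun (proj P) b) = D (pull_fun (proj P) b) &
      forall g f, pull_form (Rg g) (D f) = D (pull_fun (Rg g) f)]].

Record gauge := Gauge {
  gauge_map :> diffeo X X;
  gauge_act : forall x g, gauge_map (act P (x, g)) = act P (gauge_map x, g);
  gauge_proj : forall x, proj P (gauge_map x) = proj P x }.

Definition gauge_one : gauge :=
  @Gauge (diffeo_id X) (fun _ _ => erefl) (fun _ => erefl).

Fact gauge_mul_act (c d : gauge) x g :
  diffeo_comp c d (act P (x, g)) = act P (diffeo_comp c d x, g).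
Proof. by rewrite /= !gauge_act. Qed.
Fact gauge_mul_proj (c d : gauge) x : proj P (diffeo_comp c d x) = proj P x.
Proof. by rewrite /= !gauge_proj. Qed.
Definition gauge_mul (c d : gauge) : gauge :=
  Gauge (gauge_mul_act c d) (gauge_mul_proj c d).

Fact gauge_inv_act (c : gauge) x g :
  diffeo_inv c (act P (x, g)) = act P (diffeo_inv c x, g).
Proof. by apply: (can_inj (@dfunK _ _ _ c)); rewrite gauge_act /= !dinvK. Qed.
Fact gauge_inv_proj (c : gauge) x : proj P (diffeo_inv c x) = proj P x.
Proof. by rewrite -(gauge_proj c) /= dinvK. Qed.
Definition gauge_inv (c : gauge) : gauge :=
  Gauge (gauge_inv_act c) (gauge_inv_proj c).

Lemma gauge_ext (c d : gauge) : c =1 d -> c = d.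
Proof.
case: c d => [c ca cp] [d da dp] /= cd.
have E : c = d by exact: diffeo_ext.
by case: _ / E in da dp cd *; congr Gauge; exact: Prop_irrelevance.
Qed.

HB.instance Definition _ := gen_eqMixin gauge.
HB.instance Definition _ := gen_choiceMixin gauge.

Fact gauge_mulA : associative gauge_mul.
Proof. by move=> a b c; exact: gauge_ext. Qed.
Fact gauge_mul1 : left_id gauge_one gauge_mul.
Proof. by move=> a; exact: gauge_ext. Qed.
Fact gauge_mulr1 : right_id gauge_one gauge_mul.
Proof. by move=> a; exact: gauge_ext. Qed.
Fact gauge_mulV : left_inverse gauge_one gauge_inv gauge_mul.
Proof. by move=> a; apply: gauge_ext => x /=; rewrite dfunK. Qed.
Fact gauge_mulrV : right_inverse gauge_one gauge_inv gauge_mul.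
Proof. by move=> a; apply: gauge_ext => x /=; rewrite dinvK. Qed.
HB.instance Definition _ := isGroup.Build gauge
  gauge_mulA gauge_mul1 gauge_mulr1 gauge_mulV gauge_mulrV.

Definition gauge_P (c : gauge) (Pi : form X -> form X) : form X -> form X :=
  pull_form (diffeo_inv c) \o Pi \o pull_form c.
Definition gauge_F (c : gauge) (w : cinf G -> form X) : cinf G -> form X :=
  pull_form (diffeo_inv c) \o w.
Definition gauge_D (c : gauge) (D : cinf X -> form X) : cinf X -> form X :=
  pull_form (diffeo_inv c) \o D \o pull_fun c.

Definition gauge_acts (T : Type) (A : set T) (op : gauge -> T -> T) : Prop :=
  [/\ forall c t, A t -> A (op c t),
      forall t, A t -> op 1%g t = t &
      forall c d t, A t -> op (c * d)%g t = op c (op d t)].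

(* Linearity is what extends the formula from exact forms to all forms. *)
Definition Pi_formula (D : cinf X -> form X) (Pi : form X -> form X) : Prop :=
  linear Pi /\ forall f, Pi (form_d f) = form_d f - D f.

(* The derivative z along a vertical vector v of a function u on the fibre
   through x: v is applied to any smooth function on X extending u (values of u
   off the fibre are irrelevant). *)
Definition fibre_derivative (x : X) (v : tangent x) (u : X -> R[i]) (z : R[i]) :
    Prop :=
  let ext f := forall y, proj P y = proj P x -> f y = u y in
  (exists f : cinf X, ext f) /\ (forall f : cinf X, ext f -> v f = z).

Definition is_ver (Pi : form X -> form X) (x : X) (Y V : tangent x) : Prop :=
  forall f, V f = Pi (form_d f) x Y.

Definition omega_formula (Pi : form X -> form X) (w : cinf G -> form X) : Prop :=
  forall (h : cinf G) x (Y : tangent x), exists V : tangent x,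
    [/\ is_ver Pi Y V, vertical V &
        fibre_derivative V (fun y => h (translation x y)) (w h x Y)].

Definition D_formula (w : cinf G -> form X) (D : cinf X -> form X) : Prop :=
  forall f x (Y : tangent x),
    D f x Y = (form_d f - w (pull_fun (Rx x) f)) x Y.

Definition affine_comb (T : Type) (c : R[i]) (u v : T -> form X) : T -> form X :=
  fun s => cinf_cst X (1 - c) *: u s + cinf_cst X c *: v s.

(* For each u in A the formula determines exactly one map, which is j u. *)
Definition defines_equivariant_affine_iso (S T : Type)
    (A : set (S -> form X)) (B : set (T -> form X))
    (opA : gauge -> (S -> form X) -> (S -> form X))
    (opB : gauge -> (T -> form X) -> (T -> form X))
    (formula : (S -> form X) -> (T -> form X) -> Prop) : Prop :=
  exists j : (S -> form X) -> (T -> form X),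
    [/\ forall u, A u -> formula u (j u) /\ forall v, formula u v -> v = j u,
        set_bij A B j,
        forall c u1 u2, A u1 -> A u2 ->
          A (affine_comb c u1 u2) /\
          j (affine_comb c u1 u2) = affine_comb c (j u1) (j u2) &
        forall c u, A u -> j (opA c u) = opB c (j u)].
End Bundle.

Arguments gauge_P {R X M G} P c Pi _.
Arguments gauge_F {R X M G} P c w _.
Arguments gauge_D {R X M G} P c D _.
Arguments Pi_formula {R X} D Pi.

(* Main.v *)
From HB Require Import structures.
From mathcomp Require Import all_boot all_order all_algebra.
From mathcomp Require Import complex ring.
From mathcomp Require Import boolp classical_sets functions reals topology normedtype landau derive.
From mathcomp Require Import ereal sequences realfun exp measure lebesgue_measure lebesgue_integral ftc.
Require Import Defs.
Set Implicit Arguments.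
Unset Strict Implicit.
Unset Printing Implicit Defensive.
Import Order.TTheory GRing.Theory Num.Theory numFieldNormedType.Exports.
Local Open Scope classical_set_scope.
Local Open Scope ring_scope.

(** Why the theorem is true.

Each of the three objects is, at a point x and a tangent vector Y, a
derivation, hence a tangent vector.  For a covariant differentiation D the
map f |-> D f x Y is the horizontal part [hor Y]; for a connection Pi the map
f |-> Pi (df) x Y is the vertical part [ver Y]; for a connection form w the
map h |-> w h x Y is a tangent vector of G at the unit, which the orbit map
g |-> xg carries to the vertical part of Y.  The three formulas say that these
decompose Y in the same way:
  Y = hor Y + ver Y,   and   ver Y f = w (R_x^* f) x Y.
Thus D gives Pi by Pi a (Y) = a (Y - hor Y), which makes sense for every
form a at once ([connection_ofP]); Pi gives w by
deriving h o tau(x, .) along ver Y ([connection_form_ofP]); and w gives D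
by subtraction ([differentiation_ofP]).  The triangle of these passages
commutes: once w comes from Pi, the pair (D, Pi) satisfies the first formula
exactly when (w, D) satisfies the third ([omega_D_formula]).  Since D and Pi
determine each other, and D determines w, bijectivity of all three maps follows
from the triangle.  Affinity and equivariance are inherited from the shape of
the formulas, each formula having a single solution ([iso_of_relation]).

Three facts about manifolds carry the argument.
- Every 1-form is locally a combination of exact forms
  ([form_locally_generated]), so that a linear Pi is known from its values on
  exact forms ([linear_form_ext]).
- A vertical vector kills the functions that vanish on the fibre
  ([vertical_eq0]), so that it can be applied to functions given on the fibre
  only; such functions h o tau(x, .) have smooth extensions, which moreover
  depend smoothly on x ([translation_extension]).
- Applying a smooth vector field in the second variable to a smooth function
  of two variables gives a smooth function ([smooth_field_slice]); this is
  why the forms obtained from Pi and from w are smooth.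

Tangent vectors being derivations, all three come from the coordinate formula
v f = sum_i v (x_i) d_i f ([tangent_chart]).  It rests on Hadamard's lemma
f (u) = f (a) + sum_i (u_i - a_i) g_i (u) with smooth g_i ([hadamard],
[Ck_radial]), and on bump functions, built from exp (- 1 / t), which turn local
functions into global ones ([plateau_exists]). *)

(** * Flat functions and bump functions on vector spaces *)

Section Flat.
Variable R : realType.

(** The functions exp (- 1 / t) / t^m are taken together for all m because the
derivative of one is a combination of others, also at 0; a single induction
then gives smoothness of all of them. *)
Definition flat (m : nat) (t : R) : R :=
  if 0 < t then t^-1 ^+ m * expR (- t^-1) else 0.

Lemma flat_ge0 m t : 0 <= flat m t.
Proof.
rewrite /flat; case: ifP => // t0.
by rewrite mulr_ge0 ?expR_ge0 // exprn_ge0 // invr_ge0 ltW.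
Qed.

Lemma flat_gt0 m t : 0 < t -> 0 < flat m t.
Proof.
by move=> t0; rewrite /flat t0 mulr_gt0 ?expR_gt0// exprn_gt0// invr_gt0.
Qed.

Lemma flat_le0 m t : t <= 0 -> flat m t = 0.
Proof. by move=> t0; rewrite /flat ltNge t0. Qed.

(** From exp (1 / t) >= (1 / t)^(m+1) / (m+1)!, a term of the exponential
series; it forces every [flat m] to vanish at 0 at linear rate at least. *)
Lemma flat_bound m t : flat m t <= m.+1`!%:R * `|t|.
Proof.
rewrite /flat; case: ifP => t0; last by rewrite mulr_ge0.
have ti : 0 < t^-1 by rewrite invr_gt0.
rewrite gtr0_norm // expRN ler_pdivrMr ?expR_gt0 //.
have := @expR_ge1Dxn R t^-1 m (ltW ti).
set c : R := _%:R; have c0 : 0 < c by rewrite ltr0n fact_gt0.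
set e := expR _ => H.
have {}H : t^-1 ^+ m.+1 / c <= e by apply: le_trans H; rewrite lerDr.
have -> : t^-1 ^+ m = c * t * (t^-1 ^+ m.+1 / c).
  by rewrite exprS; field; rewrite !gt_eqF.
by rewrite ler_wpM2l // ltW // mulr_gt0.
Qed.

Lemma is_derive_flat m t :
  is_derive t (1:R) (flat m) (flat m.+2 t - m%:R * flat m.+1 t).
Proof.
have [t0|t0|->] := ltgtP t 0.
- rewrite !flat_le0 ?ltW // mulr0 subr0.
  apply: (@near_eq_is_derive _ _ _ (cst 0)) => //.
  by apply: filterS (lt_nbhsl t0) => u u0; rewrite flat_le0 // ltW.
- apply: (@near_eq_is_derive _ R^o R^o (fun u : R => u^-1 ^+ m * expR (- u^-1))).
    by apply: filterS (lt_nbhsr t0) => u u0; rewrite /flat u0.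
  have tn : t != 0 by rewrite gt_eqF.
  have di : is_derive t (1:R) (fun u : R => u^-1) (- (t ^- 2)).
    apply: is_derive_eq; first exact: (is_deriveV tn).
    by rewrite /GRing.scale /= mulr1.
  have de : is_derive t (1:R) (fun u => expR (- u^-1)) (expR (- t^-1) * t ^- 2).
    have dn : is_derive t (1:R) (fun u : R => - u^-1) (t ^- 2).
      by apply: is_derive_eq; rewrite opprK.
    have := @is_derive1_comp R expR (fun u => - u^-1) t _ _ (is_derive_expR _) dn.
    by rewrite mulrC.
  have dp : is_derive t (1:R) (fun u : R => u^-1 ^+ m) (- m%:R * t^-1 ^+ m.+1).
    rewrite (_ : (fun u => _) = (fun u : R => u^-1) ^+ m); last by rewrite exprfctE.
    apply: (is_derive_eq (is_deriveX m di)).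
    rewrite /GRing.scale /= -exprVn; set s := t^-1.
    by case: m => [|m] /=; [rewrite !mul0r oppr0 mul0r|rewrite !exprS; ring].
  apply: (is_derive_eq (is_deriveM dp de)).
  rewrite /flat t0 /GRing.scale /= -exprVn; set s := t^-1.
  by rewrite !exprS; ring.
- rewrite !flat_le0 // mulr0 subr0.
  have lim : (fun h : R => h^-1 *: ((flat m \o shift 0) (h *: 1) - flat m 0))
      @ 0^' --> (0:R).
    (* The growth rate of [flat m] at 0 is [flat m.+1], which is bounded by [flat_bound]. *)
    have bd h : h != 0 -> `|h^-1 *: ((flat m \o shift 0) (h *: 1) - flat m 0)| <=
                m.+2`!%:R * `|h|.
      move=> hn; rewrite /= addr0 [h *: 1]mulr1 (flat_le0 m (lexx 0)) subr0 /GRing.scale /=.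
      have -> : h^-1 * flat m h = flat m.+1 h.
        by rewrite /flat; case: ifP => _; rewrite ?mulr0 // exprS mulrA.
      by rewrite ger0_norm ?flat_ge0 // flat_bound.
    apply/cvgr0Pnorm_le => e e0; near=> h.
    have hn : h != 0 by near: h; exact: nbhs_dnbhs_neq.
    apply: le_trans (bd h hn) _.
    rewrite mulrC -ler_pdivlMr ?ltr0n ?fact_gt0 //.
    near: h; apply: dnbhs0_le; by rewrite divr_gt0 // ltr0n fact_gt0.
  by split; [apply/cvg_ex; exists 0|apply/cvg_lim].
Unshelve. all: by end_near.
Qed.

Lemma derive_comp1 n (q : 'rV[R]_n -> R) (f : R -> R) df x v :
  differentiable q x -> is_derive (q x) 1 f df ->
  differentiable (f \o q) x /\ 'D_v (f \o q) x = df * 'D_v q x.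
Proof.
move=> dq dfq.
have dF : differentiable f (q x) by apply/derivable1_diffP; case: dfq.
have dC : differentiable (f \o q) x by exact: differentiable_comp.
split=> //; rewrite !deriveE // diff_comp //=.
have -> : 'd q x v = 'd q x v *: (1 : R) by rewrite /GRing.scale /= mulr1.
rewrite linearZ /= -(deriveE (1 : R) dF); case: dfq => _ ->.
by rewrite /GRing.scale /= mulr1 mulrC.
Qed.

(** Composing with q directly avoids a separate notion of smoothness on the
line: the chain rule leads from [flat m] to [flat m.+1] and [flat m.+2]. *)
Lemma Ck_flat n k m (U : set 'rV[R]_n) (q : 'rV[R]_n -> R) : open U ->
  Ck k U q -> Ck k U (flat m \o q).
Proof.
move=> oU; elim: k m q => [|k IH] m q.
  move=> cq x Ux; apply: continuous_comp; first exact: cq.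
  apply: differentiable_continuous; apply/derivable1_diffP.
  by case: (is_derive_flat m (q x)).
move=> Cq; have [dq Dq] := Cq; split=> [x Ux|v].
  by have [] := derive_comp1 0 (dq x Ux) (is_derive_flat m (q x)).
apply: (@Ck_eq _ _ _ _
  (((flat m.+2 \o q) \+ (cst (- m%:R) \* (flat m.+1 \o q))) \* 'D_v q)) => //.
  move=> x Ux.
  by have [_ ->] := derive_comp1 v (dq x Ux) (is_derive_flat m (q x)); rewrite /= mulNr.
apply: CkM (Dq v) => //; apply: CkD => //; first by apply: IH; exact: CkS.
by apply: CkM => //; [exact: Ck_cst|apply: IH; exact: CkS].
Qed.

Lemma Ck_inv n k (U : set 'rV[R]_n) (q : 'rV[R]_n -> R) : open U ->
  (forall x, U x -> q x != 0) -> Ck k U q -> Ck k U (fun x => (q x)^-1).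
Proof.
move=> oU q0; elim: k => [|k IH].
  by move=> cq x Ux; apply: continuousV; [exact: q0|exact: cq].
move=> Cq; have [dq Dq] := Cq; split=> [x Ux|v].
  by apply: differentiableV; [exact: dq|exact: q0].
have Ci := IH (CkS Cq).
apply: (@Ck_eq _ _ _ _ ((cst (-1) \* (fun x => (q x)^-1)) \*
                        ((fun x => (q x)^-1) \* 'D_v q))) => //.
  move=> x Ux; rewrite deriveV ?q0 //; last by apply: diff_derivable; exact: dq.
  rewrite /= /GRing.scale /= -exprVn /cst; ring.
by apply: CkM => //; apply: CkM => //; [exact: Ck_cst|exact: Dq].
Qed.

(** The usual quotient p / (p + p') with p > 0 exactly inside a ball and p' > 0
exactly outside a smaller one.  The balls are Euclidean, the squared
Euclidean distance being smooth, whereas the norm of the space is the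
maximum norm, which is not larger. *)
Lemma bump_rV n (a : 'rV[R]_n) r : 0 < r -> exists b : 'rV[R]_n -> R,
  [/\ forall k, Ck k setT b, \forall u \near a, b u = 1 &
      forall u, r <= `|u - a| -> b u = 0].
Proof.
move=> r0; pose q (u : 'rV[R]_n) := \sum_(j < n) (u 0 j - a 0 j) ^+ 2.
have Cq k : Ck k setT q.
  apply: Ck_sum => [|j]; first exact: openT.
  have C : Ck k setT (fun u : 'rV[R]_n => u 0 j - a 0 j).
    apply: (CkD openT); first by apply: Ck_coord; exact: openT.
    exact: (@Ck_cst _ n k setT (- a 0 j)).
  rewrite (_ : (fun u => _) = (fun u : 'rV[R]_n => u 0 j - a 0 j) \*
                              (fun u : 'rV[R]_n => u 0 j - a 0 j)).
    by apply: CkM => //; exact: openT.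
  by apply/funext => u /=; rewrite expr2.
pose s2 := r ^+ 2; pose s1 := s2 / 2.
have s20 : 0 < s2 by rewrite exprn_gt0.
pose p u := flat 0 (s2 - q u); pose p' u := flat 0 (q u - s1).
have Cp k : Ck k setT p.
  apply: (@Ck_flat _ _ _ _ (fun u => s2 - q u)); first exact: openT.
  rewrite (_ : (fun u => _) = cst s2 \+ (cst (-1) \* q)); last first.
    by apply/funext => u /=; rewrite mulN1r.
  apply: CkD => //; [exact: openT|exact: Ck_cst|].
  by apply: CkM => //; [exact: openT|exact: Ck_cst].
have Cp' k : Ck k setT p'.
  apply: (@Ck_flat _ _ _ _ (fun u => q u - s1)); first exact: openT.
  by apply: (CkD openT (Cq k)); exact: (@Ck_cst _ n k setT (- s1)).
exists (fun u => p u * (p u + p' u)^-1); split.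
- move=> k; apply: (@CkM _ _ _ _ p (fun u => (p u + p' u)^-1)) => //; first exact: openT.
  apply: (@Ck_inv _ _ _ (fun u => p u + p' u)); first exact: openT.
    move=> u _; rewrite gt_eqF //.
    have [h|h] := ltP (q u) s2.
      by rewrite ltr_wpDr ?flat_ge0 // flat_gt0 // subr_gt0.
    rewrite ltr_pwDr ?flat_ge0 // flat_gt0 // subr_gt0; apply: lt_le_trans h.
    by rewrite ltr_pdivrMr // ltr_pMr // ltr1n.
  by apply: (@CkD _ _ _ _ p p') => //; exact: openT.
- have qa : q a = 0 by rewrite /q big1 // => j _; rewrite subrr expr0n.
  have cq : {for a, continuous q} by exact: (Cq 0).
  have s10 : q a < s1 by rewrite qa divr_gt0.
  have : \forall u \near a, q u < s1.
    exact: (cvgr_lt (q a) cq).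
  apply: filterS => u qu; rewrite (_ : p' u = 0) ?addr0; last first.
    by rewrite /p' flat_le0 // subr_le0 ltW.
  rewrite divff // gt_eqF // flat_gt0 // subr_gt0; apply: lt_trans qu _.
  by rewrite ltr_pdivrMr // ltr_pMr // ltr1n.
- move=> u ru; rewrite /p flat_le0 ?mul0r // subr_le0.
  have un0 : mx_norm (u - a) != 0.
    by apply: contraTneq ru => un; rewrite -ltNge; apply: le_lt_trans r0; rewrite -un.
  have [[i j] /= uij] := mx_norm_neq0 un0.
  have {}ru : r <= `|u 0 j - a 0 j|.
    by move: ru; rewrite {1}/Num.norm /= uij !mxE (ord1 i).
  apply: (@le_trans _ _ ((u 0 j - a 0 j) ^+ 2)).
    by rewrite -real_normK ?num_real // lerXn2r // nnegrE // ltW.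
  by rewrite /q (bigD1 j) //= lerDl sumr_ge0 // => i' _; exact: sqr_ge0.
Qed.
End Flat.

(** * Integrals of continuous functions over the unit interval *)

Section Integral01.
Variable R : realType.
Local Notation mu := (@lebesgue_measure R).

Definition I01 (f : R -> R) : R := (\int[mu]_(t in `[0%R, 1%R]) f t)%R.
(** Continuity at each point of the interval, in the ambient line: stronger than
continuity of the restriction, and the form in which the integrands below
are continuous. *)
Definition cont01 (f : R -> R) := forall t, `[0, 1]%classic t -> {for t, continuous f}.

Lemma cont01_integrable f : cont01 f -> mu.-integrable `[0, 1] (EFin \o f).
Proof.
move=> cf; apply: continuous_compact_integrable; first exact: segment_compact.
by apply: continuous_in_subspaceT => t; rewrite inE; exact: cf.
Qed.

Lemma I01D f g : cont01 f -> cont01 g -> I01 (f \+ g) = I01 f + I01 g.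
Proof. by move=> cf cg; apply: RintegralD => //; exact: cont01_integrable. Qed.

Lemma I01B f g : cont01 f -> cont01 g -> I01 (f \- g) = I01 f - I01 g.
Proof. by move=> cf cg; apply: RintegralB => //; exact: cont01_integrable. Qed.

Lemma I01Z c f : cont01 f -> I01 (fun t => c * f t) = c * I01 f.
Proof. by move=> cf; apply: RintegralZl => //; exact: cont01_integrable. Qed.

Lemma cont01_sum (I : Type) (s : seq I) (f : I -> R -> R) :
  (forall i, cont01 (f i)) -> cont01 (fun t => \sum_(i <- s) f i t).
Proof.
move=> cf; elim: s => [|i s IH].
  by under eq_fun do rewrite big_nil; move=> t _; exact: cst_continuous.
under eq_fun do rewrite big_cons; move=> t t01.
by apply: continuousD; [exact: cf|exact: IH].
Qed.

Lemma I01_sum (I : Type) (s : seq I) (f : I -> R -> R) :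
  (forall i, cont01 (f i)) ->
  I01 (fun t => \sum_(i <- s) f i t) = \sum_(i <- s) I01 (f i).
Proof.
move=> cf; elim: s => [|i s IH].
  under eq_fun do rewrite big_nil.
  rewrite big_nil; have c0 : cont01 (cst (0 : R)) by move=> t _; exact: cst_continuous.
  rewrite -[RHS](subrr (I01 (cst 0))) -I01B //; congr I01.
  by apply/funext => t; rewrite /= subr0.
rewrite big_cons -IH -I01D //; last exact: cont01_sum.
by congr I01; apply/funext => t; rewrite big_cons.
Qed.

Lemma I01_cst c : I01 (cst c) = c.
Proof.
have m01 : measurable (`[0%R, 1%R]%classic : set (measurableTypeR R)).
  exact: measurable_itv.
have M : mu `[0%R, 1%R]%classic = 1%E.
  by rewrite lebesgue_measure_itv /= lte_fin ltr01 oppr0 adde0.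
transitivity (c * fine (1%E : \bar R)); last by rewrite /= mulr1.
by apply: etrans (Rintegral_cst mu m01 c) _; congr (c * fine _); exact: M.
Qed.

Lemma I01_bound f c : cont01 f -> (forall t : R, `[0, 1]%classic t -> `|f t| <= c) ->
  `|I01 f| <= c.
Proof.
move=> cf fc; have m01 : measurable (`[0%R, 1%R]%classic : set (measurableTypeR R)).
  exact: measurable_itv.
have cn : cont01 (fun t => `|f t|).
  by move=> t t01; apply: continuous_comp; [exact: cf|exact: norm_continuous].
have cc : cont01 (cst c) by move=> t _; exact: cst_continuous.
rewrite -[leRHS]I01_cst; apply: le_trans (le_normr_Rintegral m01 (cont01_integrable cf)) _.
exact: le_Rintegral m01 (cont01_integrable cn) (cont01_integrable cc) fc.
Qed.

Lemma I01_FTC (f F : R -> R) : cont01 f ->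
  (forall t : R, `[0, 1]%classic t -> is_derive t (1:R) F (f t)) -> I01 f = F 1 - F 0.
Proof.
move=> cf dF.
have cF t : `[0, 1]%classic t -> {for t, continuous F}.
  move=> t01; apply: differentiable_continuous; apply/derivable1_diffP.
  by case: (dF t t01).
have oc t : t \in `]0, 1[ -> `[0, 1]%classic t.
  by rewrite /= !in_itv /= => /andP[? ?]; apply/andP; split; exact: ltW.
rewrite /I01 /Rintegral (@continuous_FTC2 _ f F) //.
- by apply: continuous_in_subspaceT => t; rewrite inE; exact: cf.
- split.
  + by move=> t /oc /dF [].
  + by apply: cvg_at_right_filter; apply: cF; rewrite /= in_itv /= lexx ler01.
  + by apply: cvg_at_left_filter; apply: cF; rewrite /= in_itv /= lexx ler01.
- by move=> t /oc /dF [? <-]; rewrite derive1E.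
Qed.
End Integral01.

Lemma Ck0 (R : realType) n k (U : set 'rV[R]_n) f :
  Ck k U f -> forall x, U x -> {for x, continuous f}.
Proof. by elim: k => // k IH /CkS. Qed.

Section Dot.
Variables (R : realType) (n : nat) (w : 'I_n -> R).
Definition dot (h : 'rV[R]_n) : R := \sum_(j < n) h 0 j * w j.
Fact dot_linear : linear dot.
Proof.
move=> c u v; rewrite /dot scaler_sumr -big_split /=; apply: eq_bigr => j _.
by rewrite !mxE /GRing.scale /=; ring.
Qed.
HB.instance Definition _ :=
  GRing.isLinear.Build R 'rV[R]_n R *:%R dot dot_linear.
Lemma dot_continuous : continuous dot.
Proof.
move=> x; apply: (@Ck_sum _ _ 0 setT _ _ (fun j h => h 0 j * w j) openT) => // j.
by apply: (CkM openT (Ck_coord _ _ openT)); exact: (@Ck_cst _ _ _ _ (w j)).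
Qed.
End Dot.

Lemma diff_linear_approx (R : realType) (V W : normedModType R) (f : V -> W)
    (L : {linear V -> W}) x : continuous L ->
  (forall e, 0 < e -> \forall h \near (0 : V), `|f (h + x) - (f x + L h)| <= e * `|h|) ->
  differentiable f x /\ 'd f x = L :> (V -> W).
Proof.
move=> cL H; have E : f \o shift x = cst (f x) + L +o_ 0 id.
  by apply/eqaddoP => e e0; exact: H.
have D := diff_unique cL E; split=> //.
by apply/diff_locallyP; rewrite D.
Qed.

(** * Hadamard's lemma *)

Section Hadamard.
Variables (R : realType) (n : nat) (a : 'rV[R]_n) (r : R).
Let U : set 'rV[R]_n := [set u | `|u - a| < r].
Implicit Type F : 'rV[R]_n -> R.

Definition seg (t : R) (u : 'rV[R]_n) : 'rV[R]_n := a + t *: (u - a).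
(** The weights t^m make the family stable under differentiation: a derivative
of [radial m F] is [radial m.+1] of the same derivative of F, the factor t
coming from the chain rule along the segment. *)
Definition radial (m : nat) F u : R := I01 (fun t => t ^+ m * F (seg t u)).

Lemma seg_in t u : `[0, 1]%classic t -> U u -> U (seg t u).
Proof.
rewrite /= in_itv /= => /andP[t0 t1]; rewrite /U /= /seg (addrC a) addrK => Uu.
by rewrite normrZ ger0_norm //; apply: le_lt_trans Uu; rewrite ler_piMl.
Qed.

Lemma seg_continuous (p : R * 'rV[R]_n) :
  {for p, continuous (fun q => seg q.1 q.2)}.
Proof.
rewrite /seg; apply: continuousD; first exact: cst_continuous.
apply: continuousZ; first exact: cvg_fst.
apply: continuousB; [exact: cvg_snd|exact: cst_continuous].
Qed.

Lemma seg_cont01 m F u : U u -> (forall x, U x -> {for x, continuous F}) ->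
  cont01 (fun t => t ^+ m * F (seg t u)).
Proof.
move=> Uu cF t t01; apply: continuousM; first exact: exprn_continuous.
apply: (@continuous_comp _ _ _ (seg^~ u) F); last exact/cF/seg_in.
rewrite /seg; apply: continuousD; first exact: cst_continuous.
by apply: continuousZ; [exact: cvg_id|exact: cst_continuous].
Qed.

(** Uniform continuity along the segment, from compactness of the interval. *)
Lemma seg_uniform F u e : 0 < e -> U u -> (forall x, U x -> {for x, continuous F}) ->
  \forall v \near u, forall t, `[0, 1]%classic t -> `|F (seg t v) - F (seg t u)| <= e.
Proof.
move=> e0 Uu cF.
have K : compact (`[0, 1]%classic : set R) by exact: segment_compact.
have /(_ _ (nbhs u) (fun v t => `|F (seg t v) - F (seg t u)| <= e)) :=
  (compact_near_coveringP _).1 K.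
apply => t t01.
have c : {for (t, u), continuous (fun q : R * 'rV[R]_n => F (seg q.1 q.2))}.
  apply: (@continuous_comp _ _ _ (fun q => seg q.1 q.2) F); last exact/cF/seg_in.
  exact: seg_continuous.
have e2 : 0 < e / 2 by rewrite divr_gt0.
have {}c : (fun q : R * 'rV[R]_n => F (seg q.1 q.2)) @ (t, u) --> F (seg t u) := c.
have /cvgrPdist_le/(_ _ e2)[[A B] /= [At Bu] AB] := c.
exists (A, B) => // -[t' v] [/= At' Bv].
have H1 := AB (t', v) (conj At' Bv); have H2 := AB (t', u) (conj At' (nbhs_singleton Bu)).
rewrite /= in H1 H2.
rewrite -(subrKA (F (seg t u))) (splitr e); apply: le_trans (ler_normD _ _) _.
by apply: lerD => //; rewrite distrC.
Qed.

Lemma derive_dot F x h : differentiable F x ->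
  'D_h F x = dot (fun j => 'D_(delta_mx 0 j) F x) h.
Proof.
move=> dF; rewrite deriveE // [X in 'd F _ X]row_sum_delta linear_sum.
by apply: eq_bigr => j _; rewrite linearZ /= -(deriveE _ dF).
Qed.

(** Both sides are limits of the same growth rates. *)
Lemma is_derive_line F x h s : differentiable F (x + s *: h) ->
  is_derive s (1 : R) (fun t => F (x + t *: h)) ('D_h F (x + s *: h)).
Proof.
move=> dF.
have E : (fun k : R => k^-1 *: (((fun t => F (x + t *: h)) \o shift s) (k *: (1 : R))
      - F (x + s *: h))) =
    (fun k => k^-1 *: ((F \o shift (x + s *: h)) (k *: h) - F (x + s *: h))).
  apply/funext => k /=; congr (_ *: (F _ - _)).
  by rewrite [k *: 1]mulr1 scalerDl addrCA.
have dh : derivable F (x + s *: h) h by exact: diff_derivable.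
by split; [rewrite /derivable E|rewrite /derive E].
Qed.

Let U_open : open U.
Proof.
rewrite (_ : U = ball a r); first exact: ball_open.
by rewrite -ball_normE; apply/funext => x; rewrite /= distrC.
Qed.

Lemma radial_continuous m F u : U u -> (forall x, U x -> {for x, continuous F}) ->
  {for u, continuous (radial m F)}.
Proof.
move=> Uu cF.
suff : radial m F @ u --> radial m F u by [].
apply: (cvgrPdist_le (F := nbhs u) _ _).2 => e e0.
have N : \forall v \near u, U v by exact: open_nbhs_nbhs.
apply: filterS2 N (seg_uniform e0 Uu cF) => v Uv H.
rewrite distrC /radial -I01B; try exact: seg_cont01.
apply: I01_bound => [t t01|t t01]; first by apply: continuousB; exact: seg_cont01.
rewrite /= -mulrBr normrM; apply: le_trans (H t t01).
move: t01; rewrite /= in_itv /= => /andP[t0 t1].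
by rewrite ler_piMl // normrX exprn_ile1 // ger0_norm.
Qed.

(** Differentiation under the integral sign.  By the mean value theorem the
increment of F at each point of the segment differs from its linear part by
the oscillation of the partial derivatives, which is uniformly small. *)
Lemma radial_diff m F u : U u -> (forall x, U x -> differentiable F x) ->
  (forall j x, U x -> {for x, continuous ('D_(delta_mx 0 j) F)}) ->
  differentiable (radial m F) u /\
  forall v, 'D_v (radial m F) u =
    dot (fun j => radial m.+1 ('D_(delta_mx 0 j) F) u) v.
Proof.
move=> Uu dF cD; pose w j := radial m.+1 ('D_(delta_mx 0 j) F) u.
have cF x : U x -> {for x, continuous F}.
  by move=> Ux; apply: differentiable_continuous; exact: dF.
suff E : forall e : R, 0 < e -> \forall h \near (0 : 'rV[R]_n),
    `|radial m F (h + u) - (radial m F u + dot w h)| <= e * `|h|.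
  have [df D] := diff_linear_approx (@dot_continuous _ _ w) E.
  by split=> // v; rewrite deriveE // D.
move=> e e0.
have e'0 : 0 < e / n.+1%:R by rewrite divr_gt0.
(* Dividing by n + 1 rather than by n keeps the case n = 0 harmless. *)
have N1 : \forall v \near u, forall j t, `[0, 1]%classic t ->
  `|'D_(delta_mx 0 j) F (seg t v) - 'D_(delta_mx 0 j) F (seg t u)| <= e / n.+1%:R.
  apply: (@filter_forall _ _ (fun j v => forall t, `[0, 1]%classic t ->
    `|'D_(delta_mx 0 j) F (seg t v) - 'D_(delta_mx 0 j) F (seg t u)| <= e / n.+1%:R)
    (nbhs u)) => j.
  exact: (seg_uniform e'0 Uu (cD j)).
have N2 : \forall v \near u, U v by exact: open_nbhs_nbhs.
have [d /= d0 B] := (nbhs_ballP (u : 'rV[R]_n) _).1 (filterI N1 N2).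
have : \forall h \near (0 : 'rV[R]_n), `|h| < d.
  apply/nbhs_ballP; exists d => // h; rewrite -ball_normE /= sub0r normrN //.
apply: filterS => h hd.
have Bs s : `[0, 1]%classic s -> ball u d (u + s *: h).
  rewrite /= in_itv /= => /andP[s0 s1]; rewrite -ball_normE /= opprD addNKr normrN.
  by rewrite normrZ ger0_norm //; apply: le_lt_trans hd; rewrite ler_piMl.
have z01 : `[0, 1]%classic (0 : R) by rewrite /= in_itv /= lexx ler01.
have o01 : `[0, 1]%classic (1 : R) by rewrite /= in_itv /= lexx ler01.
have Uh : U (u + h) by have := (B _ (Bs 1 o01)).2; rewrite scale1r.
(* The error of the linear approximation, for one t. *)
have est t : `[0, 1]%classic t -> `|F (seg t (u + h)) - F (seg t u) -
    t * dot (fun j => 'D_(delta_mx 0 j) F (seg t u)) h| <= e * `|h|.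
  move=> t01; have segD s : seg t (u + s *: h) = seg t u + s *: (t *: h).
    by rewrite /seg addrAC scalerDr addrA !scalerA mulrC.
  have Us s : `[0, 1]%classic s -> U (seg t u + s *: (t *: h)).
    by move=> s01; rewrite -segD; apply: seg_in => //; exact: (B _ (Bs s s01)).2.
  have [||c c01] := @MVT _ (fun s => F (seg t u + s *: (t *: h)))
    (fun s => 'D_(t *: h) F (seg t u + s *: (t *: h))) 0 1 ltr01.
  - move=> s s01; apply: is_derive_line; apply/dF/Us.
    by move: s01; rewrite /= !in_itv /= => /andP[? ?]; rewrite !ltW.
  - apply: continuous_in_subspaceT => s; rewrite inE => s01.
    apply: differentiable_continuous; apply/derivable1_diffP.
    by case: (is_derive_line (dF _ (Us _ s01))).
  rewrite scale0r addr0 subr0 mulr1 -segD scale1r => ->.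
  have {}c01 : `[0, 1]%classic c.
    by move: c01; rewrite /= !in_itv /= => /andP[? ?]; rewrite !ltW.
  rewrite derive_dot; last exact/dF/Us.
  rewrite linearZ /= -/(_ * _) -mulrBr normrM -segD.
  apply: (@le_trans _ _ `|dot (fun j => 'D_(delta_mx 0 j) F (seg t (u + c *: h))) h -
     dot (fun j => 'D_(delta_mx 0 j) F (seg t u)) h|).
    by move: t01; rewrite /= in_itv /= => /andP[? ?]; rewrite ler_piMl // ger0_norm.
  rewrite /dot -sumrB; apply: le_trans (ler_norm_sum _ _ _) _.
  apply: (@le_trans _ _ (\sum_(j < n) (e / n.+1%:R * `|h|))).
    apply: ler_sum => j _; rewrite -mulrBr normrM mulrC.
    apply: ler_pM => //; first by apply: (B _ (Bs c c01)).1.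
    by rewrite [leRHS]mx_normrE; apply: (le_bigmax _ (fun i => `|h i.1 i.2|) (0, j)).
  rewrite sumr_const card_ord -[_ *+ n]mulr_natr.
  have n1 : e / n.+1%:R * n%:R <= e.
    by rewrite mulrAC ler_pdivrMr // ler_pM2l // ler_nat.
  by apply: le_trans (ler_wpM2r (normr_ge0 h) n1); rewrite mulrAC.
have c1 := seg_cont01 (m := m) Uh cF; have c2 := seg_cont01 (m := m) Uu cF.
pose g j t := h 0 j * (t ^+ m.+1 * 'D_(delta_mx 0 j) F (seg t u)).
have cg j : cont01 (g j).
  move=> t t01; apply: continuousM; first exact: cst_continuous.
  exact: (seg_cont01 (m := m.+1) Uu (cD j)).
have cg' := cont01_sum (s := index_enum 'I_n) cg.
have -> : radial m F (h + u) - (radial m F u + dot w h) =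
  I01 (((fun t => t ^+ m * F (seg t (u + h))) \- (fun t => t ^+ m * F (seg t u)))
       \- (fun t => \sum_(j < n) g j t)).
  rewrite I01B //; last by move=> t t01; apply: continuousB; [exact: c1|exact: c2].
  rewrite I01B // I01_sum //.
  rewrite [h + u]addrC opprD addrA; congr (_ - _); apply: eq_bigr => j _.
  by rewrite I01Z //; exact: (seg_cont01 (m := m.+1) Uu (cD j)).
apply: I01_bound => [t t01|t t01].
  apply: continuousB; last exact: cg'.
  by apply: continuousB; [exact: c1|exact: c2].
have E : \sum_(j < n) g j t =
    t ^+ m * (t * dot (fun j => 'D_(delta_mx 0 j) F (seg t u)) h).
  by rewrite /dot !mulr_sumr; apply: eq_bigr => j _; rewrite /g exprS; ring.
rewrite /= E -!mulrBr normrM; apply: le_trans (est t t01).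
move: t01; rewrite /= in_itv /= => /andP[t0 t1].
by rewrite ler_piMl // normrX exprn_ile1 // ger0_norm.
Qed.

Lemma Ck_radial k m F : Ck k U F -> Ck k U (radial m F).
Proof.
elim: k m F => [|k IH] m F; first by move=> cF x Ux; exact: radial_continuous.
move=> CF; have [dF DF] := CF.
have cD j x : U x -> {for x, continuous ('D_(delta_mx 0 j) F)}.
  by apply: (Ck0 (DF _)).
split=> [x Ux|v]; first by have [] := radial_diff m Ux dF cD.
apply: (@Ck_eq _ _ _ _
  (fun u => \sum_(j < n) v 0 j * radial m.+1 ('D_(delta_mx 0 j) F) u)) => //.
  by move=> x Ux; have [_ ->] := radial_diff m Ux dF cD.
apply: Ck_sum => // j; apply: CkM => //; first exact: (@Ck_cst _ _ _ _ (v 0 j)).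
by apply: IH; exact: DF.
Qed.

(** The fundamental theorem of calculus for t |-> F (a + t (u - a)). *)
Lemma hadamard F : Ck 1 U F -> forall u, U u ->
  F u = F a + \sum_(j < n) (u 0 j - a 0 j) * radial 0 ('D_(delta_mx 0 j) F) u.
Proof.
move=> [dF cD] u Uu.
have c0 j : cont01 (fun t => t ^+ 0 * 'D_(delta_mx 0 j) F (seg t u)).
  exact: (seg_cont01 (m := 0) Uu (cD (delta_mx 0 j))).
pose g j t := (u - a) 0 j * (t ^+ 0 * 'D_(delta_mx 0 j) F (seg t u)).
have cg j : cont01 (g j).
  by move=> t t01; apply: continuousM; [exact: cst_continuous|exact: c0].
have E : I01 (fun t => \sum_(j < n) g j t) = F (seg 1 u) - F (seg 0 u).
  apply: (@I01_FTC _ _ (fun t => F (seg t u))); first exact: cont01_sum.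
  move=> t t01; have Ut : U (seg t u) by exact: seg_in.
  have := is_derive_line (dF _ Ut); rewrite derive_dot; last exact: dF.
  rewrite (_ : dot _ _ = \sum_(j < n) g j t) //.
  by apply: eq_bigr => j _; rewrite /g expr0 mul1r.
move: E; rewrite I01_sum // /seg scale1r scale0r addr0 (addrC a) subrK => E.
rewrite -[LHS](subrK (F a)) -E addrC; congr (_ + _); apply: eq_bigr => j _.
by rewrite I01Z // !mxE.
Qed.

(** Identifies the coefficients in [hadamard], at the centre, as the partial
derivatives. *)
Lemma radial_center F : radial 0 F a = F a.
Proof.
rewrite /radial -[RHS]I01_cst; congr I01; apply/funext => t.
by rewrite /seg subrr scaler0 addr0 expr0 mul1r.
Qed.
End Hadamard.

(** * Smooth functions on manifolds: localization and extension *)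

Lemma cball_compact (R : realType) n (a : 'rV[R]_n) r :
  compact [set u : 'rV[R]_n | `|u - a| <= r].
Proof.
apply: bounded_closed_compact.
  exists (`|a| + r); split; first exact: num_real.
  move=> M HM u Ku; apply: le_trans (ltW HM).
  by rewrite -(subrK a u) addrC; apply: le_trans (ler_normD _ _) _; rewrite lerD2l.
have cn : continuous (fun u : 'rV[R]_n => `|u - a|).
  have cs : continuous (fun u : 'rV[R]_n => u - a).
    by move=> u; apply: continuousB; [exact: cvg_id|exact: cst_continuous].
  move=> u; exact: (@continuous_comp _ _ _ _ _ u (cs u) (@norm_continuous _ _ (u - a))).
rewrite (_ : mkset _ = (fun u => `|u - a|) @^-1` [set t | t <= r]) //.
by apply: preimage_closed; [move=> u _; exact: cn|exact: closed_le].
Qed.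

Section Local_smooth.
Variables (R : realType) (X : manifold R).

Lemma smooth_fun_eq (U : set X) (f g : X -> R) : open U ->
  (forall x, U x -> f x = g x) -> smooth_fun_on U f -> smooth_fun_on U g.
Proof.
move=> oU fg sf c Ac k; apply: (@Ck_eq _ _ _ _ (f \o chart_inv c)).
- exact: chart_img_open.
- by move=> _ [x [cx Ux] <-] /=; rewrite chart_mapK // fg.
- exact: sf.
Qed.

Lemma smooth_fun_chart_comp (c : chart R X (mdim X)) (V : set 'rV[R]_(mdim X)) b :
  atlas c -> open V -> smooth_real V b ->
  smooth_fun_on (chart_dom c `&` c @^-1` V) (b \o c).
Proof.
move=> Ac oV sb d Ad k.
have oI : open (d @` (chart_dom d `&` (chart_dom c `&` c @^-1` V))).
  apply: chart_img_open; apply: open_preim => //; first exact: chart_dom_open.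
  by move=> x; exact: chart_map_continuous.
apply: (@Ck_comp _ _ _ _ _ V (fun u => c (chart_inv d u)) b) => //.
- by move=> _ [x [dx [cx Vx]] <-]; rewrite chart_mapK.
- move=> j; apply: Ck_sub (atlas_compat Ad Ac j k).
  by move=> _ [x [dx [cx Vx]] <-]; exists x.
Qed.

(** Extension by zero: chi f is smooth on U, and zero on W. *)
Lemma smooth_fun_cut (U W : set X) (chi f : X -> R) : open U -> open W ->
  (forall x, W x \/ U x) -> (forall x, W x -> chi x = 0) ->
  smooth_fun_on setT chi -> smooth_fun_on U f -> smooth_fun_on setT (chi \* f).
Proof.
move=> oU oW WU chi0 schi sf; apply: smooth_fun_local => x _.
have [Wx|Ux] := WU x; [exists W|exists U] => //.
  apply: (@smooth_fun_eq _ (cst 0)) => //; last exact: smooth_fun_cst.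
  by move=> y /chi0 /= ->; rewrite mul0r.
by apply: smooth_funM => //; apply: smooth_fun_sub schi.
Qed.

(** A bump function at x inside U.  The support condition is stated through an
open set W on which chi vanishes and which covers the complement of U: this
is what gluing with zero uses. *)
Definition plateau (x : X) (U : set X) (chi : X -> R) : Prop :=
  [/\ smooth_fun_on setT chi, exists N, [/\ open N, N x & forall y, N y -> chi y = 1] &
      exists W, [/\ open W, forall y, W y \/ U y & forall y, W y -> chi y = 0]].

(** A bump in a chart, extended by zero.  The extension is smooth because the
support is the image of a compact ball, hence closed in the Hausdorff space. *)
Lemma plateau_exists (U : set X) x : open U -> U x -> exists chi, plateau x U chi.
Proof.
move=> oU Ux; have [c Ac cx] := atlas_cover x.
pose O := c @` (chart_dom c `&` U).
have oO : open O by exact: chart_img_open.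
have Ox : O (c x) by exists x.
have /nbhs_ballP[r /= r0 B] : nbhs (c x) O by exact: open_nbhs_nbhs.
have r20 : 0 < r / 2 by rewrite divr_gt0.
have [b [sb b1 b0]] := bump_rV (c x) r20.
(* K0 contains the support of b, and K is its image in the manifold. *)
pose K0 : set 'rV[R]_(mdim X) := [set u | `|u - c x| <= r / 2].
have K0O u : K0 u -> O u.
  move=> Ku; apply: B; rewrite -ball_normE /= distrC; apply: le_lt_trans Ku _.
  by rewrite ltr_pdivrMr // ltr_pMr // ltr1n.
have cK0 : compact K0 by exact: cball_compact.
pose K := chart_inv c @` K0.
have cK : compact K.
  apply: continuous_compact cK0; apply: continuous_in_subspaceT => u.
  rewrite inE => /K0O [y [cy Uy] <-]; apply: chart_inv_continuous.
  by exists y.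
have KU y : K y -> chart_dom c y /\ U y.
  by case=> u /K0O [z [cz Uz] <-]; rewrite chart_mapK // => <-.
have oW : open (~` K) by apply: closed_openC; apply: compact_closed cK; exact: mhausdorff.
pose chi y := if `[< chart_dom c y >] then b (c y) else 0.
have chic y : chart_dom c y -> chi y = b (c y) by rewrite /chi => /asboolP ->.
have chiW y : (~` K) y -> chi y = 0.
  move=> nK; rewrite /chi; case: asboolP => // cy.
  apply: b0; rewrite leNgt; apply/negP => /ltW h; apply: nK.
  by exists (c y); rewrite ?chart_mapK.
have ocd : open (chart_dom c) by exact: chart_dom_open.
exists chi; split.
- apply: smooth_fun_local => y _; have [cy|ncy] := pselect (chart_dom c y).
    exists (chart_dom c) => //; apply: (@smooth_fun_eq _ (b \o c)) => //.
      by move=> z /chic ->.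
    have := smooth_fun_chart_comp Ac openT sb; apply: smooth_fun_sub.
    by move=> z cz; split.
  exists (~` K); first by move=> /KU [].
  apply: (@smooth_fun_eq _ (cst 0)) => //; last exact: smooth_fun_cst.
  by move=> z /chiW ->.
- pose N := [set u | b u = 1]°; have oN : open N by exact: open_interior.
  have Nx : N (c x) by exact: b1.
  exists (chart_dom c `&` c @^-1` N); split => //.
    apply: open_preim => // y; exact: chart_map_continuous.
  by move=> y [cy Ny]; rewrite chic //; exact: (interior_subset Ny).
- exists (~` K); split => // y.
  by have [/KU[_ ?]|?] := pselect (K y); [right|left].
Qed.
End Local_smooth.

Section Complex_smooth.
Variable R : realType.
Implicit Types X Y : manifold R.

(** On the whole space this is [smooth_cfun], by conversion. *)
Definition csmooth_on X (U : set X) (f : X -> R[i]) : Prop :=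
  smooth_fun_on U (fun x => complex.Re (f x)) /\
  smooth_fun_on U (fun x => complex.Im (f x)).

Lemma csmooth_local X (U : set X) f :
  (forall x, U x -> exists2 N, N x & csmooth_on N f) -> csmooth_on U f.
Proof.
by move=> H; split; apply: smooth_fun_local => x /H[N Nx []]; exists N.
Qed.

Lemma csmooth_sub X (U V : set X) f : U `<=` V -> csmooth_on V f -> csmooth_on U f.
Proof. by move=> UV [f1 f2]; split; apply: smooth_fun_sub UV _. Qed.

Lemma csmooth_eq X (U : set X) f g : open U -> (forall x, U x -> f x = g x) ->
  csmooth_on U f -> csmooth_on U g.
Proof.
by move=> oU fg [f1 f2]; split; [apply: smooth_fun_eq f1|apply: smooth_fun_eq f2] => //
  x /fg ->.
Qed.

Lemma csmooth_cst X (U : set X) a : csmooth_on U (cst a).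
Proof. by split; exact: smooth_fun_cst. Qed.

Lemma csmoothD X (U : set X) f g : open U -> csmooth_on U f -> csmooth_on U g ->
  csmooth_on U (fun x => f x + g x).
Proof.
move=> oU [f1 f2] [g1 g2]; split.
  apply: smooth_fun_eq (smooth_funD oU f1 g1) => // x _ /=.
  by case: (f x) (g x) => ? ? [].
apply: smooth_fun_eq (smooth_funD oU f2 g2) => // x _ /=.
by case: (f x) (g x) => ? ? [].
Qed.

Lemma csmoothM X (U : set X) f g : open U -> csmooth_on U f -> csmooth_on U g ->
  csmooth_on U (fun x => f x * g x).
Proof.
move=> oU [f1 f2] [g1 g2]; split.
  apply: smooth_fun_eq (smooth_funD oU (smooth_funM oU f1 g1)
    (smooth_funN oU (smooth_funM oU f2 g2))) => // x _ /=.
  by case: (f x) (g x) => ? ? [].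
apply: smooth_fun_eq (smooth_funD oU (smooth_funM oU f1 g2) (smooth_funM oU f2 g1)) => // x _ /=.
by case: (f x) (g x) => ? ? [].
Qed.

Lemma csmooth_sum X (U : set X) (I : Type) (r : seq I) (f : I -> X -> R[i]) :
  open U -> (forall i, csmooth_on U (f i)) ->
  csmooth_on U (fun x => \sum_(i <- r) f i x).
Proof.
move=> oU sf; elim: r => [|i r IH].
  by under eq_fun do rewrite big_nil; exact: csmooth_cst.
by under eq_fun do rewrite big_cons; exact: csmoothD.
Qed.

Lemma csmooth_real X (U : set X) (r : X -> R) : smooth_fun_on U r ->
  csmooth_on U (fun x => (r x)%:C%C).
Proof. by move=> sr; split => //=; exact: smooth_fun_cst. Qed.

Lemma csmooth_cut X (U W : set X) (chi : X -> R) f : open U -> open W ->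
  (forall x, W x \/ U x) -> (forall x, W x -> chi x = 0) ->
  smooth_fun_on setT chi -> csmooth_on U f ->
  csmooth_on setT (fun x => (chi x)%:C%C * f x).
Proof.
move=> oU oW WU chi0 schi [f1 f2]; have oT := @openT X; split.
  apply: smooth_fun_eq (smooth_fun_cut oU oW WU chi0 schi f1) => // x _ /=.
  by case: (f x) => a b /=; rewrite mul0r subr0.
apply: smooth_fun_eq (smooth_fun_cut oU oW WU chi0 schi f2) => // x _ /=.
by case: (f x) => a b /=; rewrite mul0r addr0.
Qed.

Lemma csmooth_comp X Y (U : set X) (W : set Y) (f : X -> Y) (g : Y -> R[i]) :
  open U -> open W -> smooth_map_on U f -> csmooth_on W g ->
  (forall x, U x -> W (f x)) -> csmooth_on U (g \o f).
Proof.
move=> oU oW sf [g1 g2] UW.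
have H : U `<=` U `&` f @^-1` W by move=> x Ux; split=> //; exact: UW.
split; apply: smooth_fun_sub H _.
  exact: (smooth_fun_comp oU oW sf g1).
exact: (smooth_fun_comp oU oW sf g2).
Qed.
End Complex_smooth.

Lemma cinf_sumE (R : realType) (X : manifold R) (I : Type) (s : seq I)
    (h : I -> cinf X) y : (\sum_(i <- s) h i) y = \sum_(i <- s) h i y.
Proof.
elim: s => [|i s IH]; first by rewrite !big_nil.
by rewrite !big_cons -IH.
Qed.

(** * Tangent vectors in coordinates *)

Section Tangent_local.
Variables (R : realType) (X : manifold R) (x : X).
Implicit Types (v : tangent x) (f g : cinf X).

Lemma tangentD v f g : v (f + g) = v f + v g.
Proof.
have [H _] := tangentP v; have := H 1 f g; rewrite mul1r => <-.
by congr (v (_ + _)); apply: cinf_ext => y; rewrite -[LHS]mul1r.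
Qed.

Lemma tangentM v f g : v (f * g) = v f * g x + f x * v g.
Proof. by have [_ ->] := tangentP v. Qed.

Lemma tangent0 v : v 0 = 0.
Proof. by apply: (addIr (v 0)); rewrite -tangentD !add0r. Qed.

Lemma tangentZ v a f : v (cinf_cst X a * f) = a * v f.
Proof.
have [H _] := tangentP v; have := H a f 0; by rewrite tangent0 !addr0.
Qed.

Lemma tangent1 v : v 1 = 0.
Proof.
have := tangentM v 1 1; rewrite mulr1 -[(1 : cinf X) x]/(1 : R[i]) mulr1 mul1r.
by move=> H; apply: (addIr (v 1)); rewrite -H add0r.
Qed.

Lemma tangent_cst v a : v (cinf_cst X a) = 0.
Proof. by rewrite -[cinf_cst X a]mulr1 tangentZ tangent1 mulr0. Qed.

Lemma tangentN v f : v (- f) = - v f.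
Proof. by apply: (addIr (v f)); rewrite -tangentD !addNr tangent0. Qed.

Lemma tangentB v f g : v (f - g) = v f - v g.
Proof. by rewrite tangentD tangentN. Qed.

Lemma tangent_sum v (I : Type) (r : seq I) (f : I -> cinf X) :
  v (\sum_(i <- r) f i) = \sum_(i <- r) v (f i).
Proof.
elim: r => [|i r IH]; first by rewrite !big_nil tangent0.
by rewrite !big_cons tangentD IH.
Qed.

(** If f = g near x then f - g = (f - g)(1 - chi) for a bump function chi at x
supported where f = g, and both factors vanish at x. *)
Lemma tangent_local v f g : (\near x, f x = g x) -> v f = v g.
Proof.
move=> fgx; pose N := [set y | f y = g y]°.
have oN : open N by exact: open_interior.
have Nx : N x by exact: fgx.
have fg y : N y -> f y = g y by move=> Ny; exact: (interior_subset Ny).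
have [chi [schi [N' [_ N'x chi1]] [W [oW WN chi0]]]] := plateau_exists oN Nx.
pose k : cinf X := to_cinf (csmooth_real schi).
apply/eqP; rewrite -subr_eq0 -tangentB.
have -> : f - g = (f - g) * (1 - k).
  apply: cinf_ext => y.
  rewrite -[RHS]/((f y - g y) * (1 - (chi y)%:C%C)) -[LHS]/(f y - g y).
  case: (WN y) => [/chi0 ->|/fg ->]; first by rewrite subr0 mulr1.
  by rewrite subrr mul0r.
rewrite tangentM -[(f - g) x]/(f x - g x) -[(1 - k) x]/(1 - (chi x)%:C%C).
by rewrite chi1 // (fg x Nx) !subrr mul0r mulr0 addr0.
Qed.
End Tangent_local.

Section Partial.
Variables (R : realType) (X : manifold R) (c : chart R X (mdim X)).
Hypothesis Ac : atlas c.
Implicit Types (i : 'I_(mdim X)) (r : X -> R) (f g : X -> R[i]).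

Definition real_partial i r x : R := 'D_(delta_mx 0 i) (r \o chart_inv c) (c x).

Definition partial i f x : R[i] :=
  Complex (real_partial i (fun y => complex.Re (f y)) x)
          (real_partial i (fun y => complex.Im (f y)) x).

Lemma smooth_real_partial i r (V : set X) : open V -> smooth_fun_on V r ->
  smooth_fun_on (chart_dom c `&` V) (real_partial i r).
Proof.
move=> oV sr d Ad k.
have oI : open (d @` (chart_dom d `&` (chart_dom c `&` V))).
  by apply: chart_img_open; apply: openI => //; exact: chart_dom_open.
apply: (@Ck_comp _ _ _ _ _ (c @` (chart_dom c `&` V)) (fun u => c (chart_inv d u))
         ('D_(delta_mx 0 i) (r \o chart_inv c))) => //.
- by move=> _ [x [dx [cx Vx]] <-]; rewrite chart_mapK //; exists x.
- move=> j; apply: Ck_sub (atlas_compat Ad Ac j k).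
  by move=> _ [x [dx [cx Vx]] <-]; exists x.
- by have [_] := sr c Ac k.+1; exact.
Qed.

Lemma csmooth_partial i f : smooth_cfun f -> csmooth_on (chart_dom c) (partial i f).
Proof.
move=> [f1 f2]; split => /=.
  apply: smooth_fun_sub (smooth_real_partial i openT f1); by move=> x cx; split.
apply: smooth_fun_sub (smooth_real_partial i openT f2); by move=> x cx; split.
Qed.

Variables (x : X) (cx : chart_dom c x).

Lemma smooth_diff r : smooth_fun_on setT r ->
  differentiable (r \o chart_inv c) (c x).
Proof.
by move=> sr; have [H _] := sr c Ac 1%N; apply: H; exists x.
Qed.

Lemma real_partialD i r1 r2 : smooth_fun_on setT r1 -> smooth_fun_on setT r2 ->
  real_partial i (fun y => r1 y + r2 y) x = real_partial i r1 x + real_partial i r2 x.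
Proof.
move=> s1 s2; rewrite /real_partial.
by apply: (@deriveD _ _ _ (r1 \o chart_inv c) (r2 \o chart_inv c));
  apply: diff_derivable; exact: smooth_diff.
Qed.

Lemma real_partialM i r1 r2 : smooth_fun_on setT r1 -> smooth_fun_on setT r2 ->
  real_partial i (fun y => r1 y * r2 y) x =
  r1 x * real_partial i r2 x + r2 x * real_partial i r1 x.
Proof.
move=> s1 s2; rewrite /real_partial.
have := @deriveM _ _ (r1 \o chart_inv c) (r2 \o chart_inv c) (c x) (delta_mx 0 i)
  (diff_derivable (smooth_diff s1)) (diff_derivable (smooth_diff s2)).
by rewrite /= chart_mapK.
Qed.

Lemma real_partial_cst i a : real_partial i (fun=> a) x = 0.
Proof. exact: derive_cst. Qed.

Lemma partial_cst i a : partial i (fun=> a) x = 0.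
Proof. by rewrite /partial !real_partial_cst. Qed.

Lemma partialD i f g : smooth_cfun f -> smooth_cfun g ->
  partial i (fun y => f y + g y) x = partial i f x + partial i g x.
Proof.
move=> [f1 f2] [g1 g2]; rewrite /partial.
rewrite (_ : (fun y => complex.Re _) =
             (fun y => complex.Re (f y) + complex.Re (g y))); last first.
  by apply/funext => y; case: (f y) (g y) => ? ? [].
rewrite (_ : (fun y => complex.Im _) =
             (fun y => complex.Im (f y) + complex.Im (g y))); last first.
  by apply/funext => y; case: (f y) (g y) => ? ? [].
by rewrite !real_partialD.
Qed.

Lemma partialM i f g : smooth_cfun f -> smooth_cfun g ->
  partial i (fun y => f y * g y) x = partial i f x * g x + f x * partial i g x.
Proof.
move=> [f1 f2] [g1 g2]; rewrite /partial.
pose rf y := complex.Re (f y); pose mf y := complex.Im (f y).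
pose rg y := complex.Re (g y); pose mg y := complex.Im (g y).
have s U (h k : X -> R) := @smooth_funM _ _ U h k.
rewrite (_ : (fun y => complex.Re _) = (fun y => rf y * rg y + - (mf y * mg y))); last first.
  by apply/funext => y; rewrite /rf /rg /mf /mg; case: (f y) (g y) => ? ? [].
rewrite (_ : (fun y => complex.Im _) = (fun y => rf y * mg y + mf y * rg y)); last first.
  by apply/funext => y; rewrite /rf /rg /mf /mg; case: (f y) (g y) => ? ? [].
have oT := @openT X.
have N : real_partial i (fun y => - (mf y * mg y)) x =
         - real_partial i (fun y => mf y * mg y) x.
  apply/eqP; rewrite -addr_eq0 -real_partialD; last 2 first.
  - by apply: smooth_funN => //; exact: (s _ mf mg).
  - exact: (s _ mf mg).
  apply/eqP; rewrite -(real_partial_cst i 0); congr (real_partial i _ x).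
  by apply/funext => y; rewrite addNr.
rewrite !real_partialD ?N ?real_partialM //; try exact: (s _ mf mg); try exact: (s _ rf mg);
  try exact: (s _ mf rg); try exact: (s _ rf rg); last first.
  by apply: smooth_funN => //; exact: (s _ mf mg).
rewrite -/(rf x) -/(mf x).
rewrite (_ : f x = Complex (rf x) (mf x)); last by rewrite /rf /mf; case: (f x).
rewrite (_ : g x = Complex (rg x) (mg x)); last by rewrite /rg /mg; case: (g x).
by apply/eqP; rewrite eq_complex /= -/rf -/mf -/rg -/mg; apply/andP; split; apply/eqP; ring.
Qed.
End Partial.

Section Coordinates.
Variables (R : realType) (X : manifold R) (c : chart R X (mdim X)).
Hypothesis Ac : atlas c.

Definition cinf_real (r : X -> R) (sr : smooth_fun_on setT r) : cinf X :=
  to_cinf (csmooth_real sr).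

(** Near x, Hadamard's lemma writes r as a constant plus a sum of products of
two functions, of which one, the coordinate difference, vanishes at x; the
Leibniz rule keeps only the value of the other at x. *)
Lemma tangent_chart_real (phi : 'I_(mdim X) -> cinf X) x (v : tangent x) (r : X -> R)
    (sr : smooth_fun_on setT r) (N : set X) : chart_dom c x -> open N -> N x ->
  (forall y i, N y -> phi i y = (c y 0 i)%:C%C) ->
  v (cinf_real sr) = \sum_i v (phi i) * (real_partial c i r x)%:C%C.
Proof.
move=> cx oN Nx phiN.
pose O := c @` (chart_dom c `&` N).
have oO : open O by exact: chart_img_open.
have Ox : O (c x) by exists x.
have /nbhs_ballP[rho /= rho0 B] : nbhs (c x) O by exact: open_nbhs_nbhs.
pose F := r \o chart_inv c.
pose U : set 'rV[R]_(mdim X) := [set u | `|u - c x| < rho].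
have UB : U = ball (c x) rho.
  by rewrite -ball_normE; apply/funext => y; rewrite /U /= distrC.
have oU : open U by rewrite UB; exact: ball_open.
have sF k : Ck k U F.
  apply: Ck_sub (sr c Ac k) => u Uu.
  have : O u by apply: B; rewrite -UB.
  by case=> y [cy Ny] <-; exists y.
pose g i := radial (c x) 0 ('D_(delta_mx 0 i) F).
have sg i : smooth_real U (g i).
  by move=> k; apply: Ck_radial; have [_] := sF k.+1; exact.
pose V := chart_dom c `&` c @^-1` U.
have oV : open V.
  apply: open_preim => //; first exact: chart_dom_open.
  by move=> y; exact: chart_map_continuous.
have Vx : V x by split=> //; rewrite /U /= subrr normr0.
have [chi [schi [M [oM Mx chi1]] [W [oW WV chi0]]]] := plateau_exists oV Vx.
have sG i : smooth_fun_on setT (chi \* (g i \o c)).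
  apply: smooth_fun_cut schi _; [exact: oV|exact: oW|by []|by []|].
  exact: smooth_fun_chart_comp.
pose G i := cinf_real (sG i).
have E : v (cinf_real sr) = v (cinf_cst X (r x)%:C%C +
    \sum_i (phi i - cinf_cst X (c x 0 i)%:C%C) * G i).
  apply: tangent_local.
  have : nbhs x ((V `&` M) `&` N).
    by apply: open_nbhs_nbhs; split => //; apply: openI => //; exact: openI.
  apply: filterS => y [[[cy Uy] My] Ny].
  have := hadamard (sF 1%N) Uy; rewrite /F /= !chart_mapK // => ->.
  rewrite -[RHS]/((r x)%:C%C + (\sum_i (phi i - cinf_cst X (c x 0 i)%:C%C) * G i : cinf X) y).
  rewrite cinf_sumE rmorphD rmorph_sum /=; congr (_ + _); apply: eq_bigr => i _.
  rewrite -[RHS]/((phi i y - (c x 0 i)%:C%C) * (chi y * g i (c y))%:C%C).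
  by rewrite (chi1 _ My) mul1r phiN // rmorphM rmorphB.
rewrite E tangentD tangent_cst add0r tangent_sum; apply: eq_bigr => i _.
rewrite tangentM tangentB tangent_cst subr0.
rewrite -[X in _ + X * _]/(phi i x - (c x 0 i)%:C%C) phiN // subrr mul0r addr0.
rewrite -[G i x]/((chi x * g i (c x))%:C%C) chi1 // mul1r; congr (_ * _%:C%C).
exact: radial_center.
Qed.

(** The functions phi_i are the coordinates multiplied by a bump function, and
serve for all points near x0 at once. *)
Lemma tangent_chart (x0 : X) : chart_dom c x0 ->
  exists (phi : 'I_(mdim X) -> cinf X) (N : set X),
    [/\ open N, N x0, N `<=` chart_dom c &
        forall x (v : tangent x) f, N x -> v f = \sum_i v (phi i) * partial c i f x].
Proof.
move=> cx0.
have ocd : open (chart_dom c) by exact: chart_dom_open.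
have [chi [schi [N [oN Nx chi1]] [W [oW Wc chi0]]]] := plateau_exists ocd cx0.
have sphi i : smooth_fun_on setT (chi \* (fun y => c y 0 i)).
  by apply: smooth_fun_cut schi _; [exact: ocd|exact: oW|by []|by []|exact: smooth_fun_chart].
exists (fun i => cinf_real (sphi i)), (chart_dom c `&` N); split => //.
  exact: openI.
move=> x v f [cx Nxx].
have [sRe sIm] := cinfP f.
have E : f = cinf_real sRe + cinf_cst X 'i%C * cinf_real sIm.
  by apply: cinf_ext => y; rewrite {1}[f y]complexE.
have H r (sr : smooth_fun_on setT r) :
    v (cinf_real sr) = \sum_i v (cinf_real (sphi i)) * (real_partial c i r x)%:C%C.
  apply: (@tangent_chart_real (fun i => cinf_real (sphi i)) x v r sr N) => //.
  by move=> y i Ny /=; rewrite chi1 // mul1r.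
rewrite {1}E tangentD tangentZ !H mulr_sumr -big_split /=; apply: eq_bigr => i _.
by rewrite mulrCA -mulrDr; congr (_ * _); rewrite /partial [RHS]complexE /=.
Qed.
End Coordinates.

(** * Forms and exact forms *)

Section Form_calculus.
Variables (R : realType) (X : manifold R).

Lemma formDE (a b : form X) x v : (a + b) x v = a x v + b x v. Proof. by []. Qed.
Lemma formZE f (a : form X) x v : (f *: a) x v = f x * a x v. Proof. by []. Qed.
Lemma formNE (a : form X) x v : (- a) x v = - a x v. Proof. by []. Qed.
Lemma form0E x v : (0 : form X) x v = 0. Proof. by []. Qed.
Lemma form_dE f x v : (form_d f : form X) x v = v f. Proof. by []. Qed.
Definition formE := (formDE, formZE, formNE, form0E, form_dE).

(** For base points that are equal but not convertible, such as x and
(x g) g^-1, where the tangent spaces are different types. *)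
Lemma form_congr (a : form X) x y (v : tangent x) (w : tangent y) :
  x = y -> (forall f, v f = w f) -> a x v = a y w.
Proof. by move=> xy; case: _ / xy w => w /tangent_ext ->. Qed.

Lemma form_valD (a : form X) x (u v : tangent x) : a x (u + v) = a x u + a x v.
Proof. by have := @form_linear _ _ a x 1 u v; rewrite scale1r mul1r. Qed.

Lemma form_val0 (a : form X) x : a x 0 = 0.
Proof. by apply: (addIr (a x 0)); rewrite -form_valD !add0r. Qed.

Lemma form_valZ (a : form X) x c (v : tangent x) : a x (c *: v) = c * a x v.
Proof. by rewrite -[c *: v]addr0 form_linear form_val0 addr0. Qed.

Lemma form_valB (a : form X) x (u v : tangent x) : a x (u - v) = a x u - a x v.
Proof. by rewrite form_valD -scaleN1r form_valZ mulN1r. Qed.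

Lemma form_dD f g : form_d (f + g) = form_d f + form_d g :> form X.
Proof. by apply: form_ext => x v; rewrite !formE tangentD. Qed.

Lemma form_dZ c f : form_d (cinf_cst X c * f) = cinf_cst X c *: form_d f.
Proof. by apply: form_ext => x v; rewrite !formE tangentZ. Qed.

Lemma form_dM f g : form_d (f * g) = g *: form_d f + f *: form_d g :> form X.
Proof. by apply: form_ext => x v; rewrite !formE tangentM mulrC. Qed.

Lemma linear_formD (L : form X -> form X) : linear L -> forall a b, L (a + b) = L a + L b.
Proof. by move=> lL a b; have := lL 1 a b; rewrite !scale1r. Qed.

Lemma linear_form0 (L : form X -> form X) : linear L -> L 0 = 0.
Proof. by move=> lL; apply: (addIr (L 0)); rewrite -(linear_formD lL) !add0r. Qed.

Lemma linear_formZ (L : form X -> form X) : linear L -> forall f a, L (f *: a) = f *: L a.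
Proof. by move=> lL f a; have := lL f a 0; rewrite (linear_form0 lL) !addr0. Qed.

Lemma linear_formB (L : form X -> form X) : linear L -> forall a b, L (a - b) = L a - L b.
Proof. by move=> lL a b; rewrite (linear_formD lL) -scaleN1r (linear_formZ lL) scaleN1r. Qed.
End Form_calculus.

Section Frame.
Variables (R : realType) (X : manifold R).

(** The coordinate formula multiplied by a bump function, so that the vector
fields E_i and the identity make sense on the whole manifold. *)
Lemma local_frame (x0 : X) : exists (chi : cinf X) (n : nat)
    (phi : 'I_n -> cinf X) (E : 'I_n -> forall x : X, tangent x),
  [/\ chi x0 = 1, forall i, smooth_field (E i) &
      forall x (v : tangent x) f, chi x * v f = \sum_i v (phi i) * E i x f].
Proof.
have [c Ac cx0] := atlas_cover x0.
have [phi [N [oN Nx0 Nc Nphi]]] := tangent_chart Ac cx0.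
have [chi [schi [M [oM Mx chi1]] [W [oW WN chi0]]]] := plateau_exists oN Nx0.
have dE i x : derivation_at x (fun f => (chi x)%:C%C * partial c i f x).
  have [/chi0 ->|/Nc cx] := WN x; first by split=> *; ring.
  split=> [a f g|f g].
    rewrite -[partial c i _ x]/(partial c i (fun y => a * f y + g y) x).
    have sa := cinfP (cinf_cst X a * f).
    rewrite (@partialD _ _ c Ac _ cx i (fun y => a * f y)) //; last exact: cinfP.
    rewrite (@partialM _ _ c Ac _ cx i (fun=> a)) ?partial_cst //; first by ring.
      exact: cst_smooth_cfun.
    exact: cinfP.
  rewrite -[partial c i _ x]/(partial c i (fun y => f y * g y) x).
  by rewrite (@partialM _ _ c Ac _ cx i f g) //; [ring|exact: cinfP|exact: cinfP].
pose E i x := to_tangent (dE i x).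
exists (to_cinf (csmooth_real schi)), (mdim X), phi, E; split.
- by rewrite /= chi1.
- move=> i f; apply: (csmooth_cut oN oW) => //.
  by apply: csmooth_sub Nc _; apply: csmooth_partial => //; exact: cinfP.
- move=> x v f /=; have [/chi0 ->|Nx] := WN x.
    by rewrite mul0r big1 // => i _; rewrite mul0r mulr0.
  rewrite (Nphi _ v f Nx) mulr_sumr; apply: eq_bigr => i _.
  by rewrite mulrCA.
Qed.

Lemma form_sum (a : form X) x (I : Type) (r : seq I) (c : I -> R[i])
    (v : I -> tangent x) :
  a x (\sum_(i <- r) c i *: v i) = \sum_(i <- r) c i * a x (v i).
Proof.
elim: r => [|i r IH]; first by rewrite !big_nil form_val0.
by rewrite !big_cons form_linear IH.
Qed.

Lemma sum_formE (I : Type) (r : seq I) (a : I -> form X) x (v : tangent x) :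
  (\sum_(i <- r) a i : form X) x v = \sum_(i <- r) a i x v.
Proof.
elim: r => [|i r IH]; first by rewrite !big_nil.
by rewrite !big_cons -IH.
Qed.

(** Apply the form to the frame expansion of chi v: the coefficients are the
smooth functions a (E_i). *)
Lemma form_locally_generated (a : form X) (x0 : X) : exists (chi : cinf X) (n : nat)
    (g phi : 'I_n -> cinf X),
  chi x0 = 1 /\ chi *: a = \sum_i g i *: form_d (phi i).
Proof.
have [chi [n [phi [E [chi1 sE frame]]]]] := local_frame x0.
exists chi, n, (fun i => to_cinf (form_smooth a (sE i))), phi; split=> //.
apply: form_ext => x v; rewrite sum_formE.
transitivity (a x (chi x *: v)).
  by have := form_sum a [:: tt] (fun=> chi x) (fun=> v); rewrite !big_seq1 => ->.
have -> : chi x *: v = \sum_i v (phi i) *: E i x.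
  apply: tangent_ext => f.
  have tangent_sumE (I : Type) (r : seq I) (w : I -> tangent x) :
      (\sum_(i <- r) w i : tangent x) f = \sum_(i <- r) w i f.
    elim: r => [|i r IH]; first by rewrite !big_nil.
    by rewrite !big_cons -IH.
  by rewrite tangent_sumE; exact: frame.
rewrite form_sum; apply: eq_bigr => i _.
by rewrite -[RHS]/(a x (E i x) * v (phi i)) mulrC.
Qed.

(** At x a form may be multiplied by chi, which is 1 there, and a linear map lets
chi through; so generation of the form near x is enough. *)
Lemma linear_form_ext (A B : form X -> form X) : linear A -> linear B ->
  (forall f, A (form_d f) = B (form_d f)) -> A = B.
Proof.
move=> lA lB AB; apply/funext => a; apply: form_ext => x v.
have [chi [n [g [phi [chi1 gen]]]]] := form_locally_generated a x.
have H (b : form X) : b x v = (chi *: b) x v.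
  by rewrite -[RHS]/(chi x * b x v) chi1 mul1r.
rewrite H [RHS]H -(linear_formZ lA) -(linear_formZ lB) gen.
have S (L : form X -> form X) : linear L ->
    L (\sum_i g i *: form_d (phi i)) = \sum_i g i *: L (form_d (phi i)).
  move=> lL; elim/big_rec2: _ => [|i a1 a2 _ <-]; first exact: linear_form0.
  by rewrite (linear_formD lL) (linear_formZ lL).
suff -> : A (\sum_i g i *: form_d (phi i)) = B (\sum_i g i *: form_d (phi i)) by [].
by rewrite (S A lA) (S B lB); apply: eq_bigr => i _; rewrite AB.
Qed.
End Frame.

(** * Functions of two variables *)

Section Product.
Variables (R : realType) (X Y : manifold R).
Local Notation XY := (prod_manifold X Y).

Definition slice_l (F : cinf XY) (y : Y) : cinf X :=
  pull_fun (smap_pair (smap_id X) (smap_cst X y)) F.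
Definition slice_r (F : cinf XY) (x : X) : cinf Y :=
  pull_fun (smap_pair (smap_cst Y x) (smap_id Y)) F.

Fact fst_smooth : smooth_map_on (X := XY) setT (fun p : XY => p.1).
Proof.
split=> [p _|d Ad j]; first exact: cvg_fst.
apply: smooth_fun_local => -[x y] [_ /= dx].
have [e Ae ey] := atlas_cover y.
have Ade : atlas (prod_chart d e : chart R XY _) by exists d, e.
exists (chart_dom (prod_chart d e)) => //.
have := smooth_fun_chart (lshift _ j : 'I_(mdim XY)) Ade.
by congr smooth_fun_on; apply/funext => p; exact: row_mxEl.
Qed.
Definition smap_fst : smap XY X := Smap fst_smooth.

Fact snd_smooth : smooth_map_on (X := XY) setT (fun p : XY => p.2).
Proof.
split=> [p _|d Ad j]; first exact: cvg_snd.
apply: smooth_fun_local => -[x y] [_ /= dy].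
have [e Ae ex] := atlas_cover x.
have Aed : atlas (prod_chart e d : chart R XY _) by exists e, d.
exists (chart_dom (prod_chart e d)) => //.
have := smooth_fun_chart (rshift _ j : 'I_(mdim XY)) Aed.
by congr smooth_fun_on; apply/funext => p; exact: row_mxEr.
Qed.
Definition smap_snd : smap XY Y := Smap snd_smooth.

Variables (c : chart R X (mdim X)) (d : chart R Y (mdim Y)).
Local Notation e := (prod_chart c d : chart R XY (mdim XY)).

Lemma real_partial_prod_l i (r : XY -> R) x y : chart_dom c x -> chart_dom d y ->
  real_partial e (lshift _ i : 'I_(mdim XY)) r (x, y) =
  real_partial c i (fun z => r (z, y)) x.
Proof.
move=> cx dy; rewrite /real_partial /derive.
apply: (congr1 (fun q : R -> R => lim (q @ (0 : R)^'))).
apply/funext => h /=; congr (_ *: (r (_, _) - _)).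
- congr (chart_inv c _); rewrite linearD linearZ /= row_mxKl; congr (_ *: _ + _).
  by apply/rowP => j; rewrite !mxE (inj_eq (@lshift_inj _ _)).
- transitivity (chart_inv d (d y)); last exact: chart_mapK.
  congr (chart_inv d _); rewrite linearD linearZ /= row_mxKr.
  rewrite (_ : rsubmx _ = 0) ?scaler0 ?add0r //.
  by apply/rowP => j; rewrite !mxE eq_rlshift andbF.
- by rewrite row_mxKl row_mxKr !chart_mapK.
Qed.

Lemma real_partial_prod_r i (r : XY -> R) x y : chart_dom c x -> chart_dom d y ->
  real_partial e (rshift _ i : 'I_(mdim XY)) r (x, y) =
  real_partial d i (fun z => r (x, z)) y.
Proof.
move=> cx dy; rewrite /real_partial /derive.
apply: (congr1 (fun q : R -> R => lim (q @ (0 : R)^'))).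
apply/funext => h /=; congr (_ *: (r (_, _) - _)).
- transitivity (chart_inv c (c x)); last exact: chart_mapK.
  congr (chart_inv c _); rewrite linearD linearZ /= row_mxKl.
  rewrite (_ : lsubmx _ = 0) ?scaler0 ?add0r //.
  by apply/rowP => j; rewrite !mxE eq_lrshift andbF.
- congr (chart_inv d _); rewrite linearD linearZ /= row_mxKr; congr (_ *: _ + _).
  by apply/rowP => j; rewrite !mxE (inj_eq (@rshift_inj _ _)).
- by rewrite row_mxKl row_mxKr !chart_mapK.
Qed.
End Product.

Section Product_tangent.
Variables (R : realType) (X Y : manifold R).
Local Notation XY := (prod_manifold X Y).

(** In product charts each coordinate direction is tangent to one of the two
slices, along which F is constant. *)
Lemma tangent_prod_eq0 x y (w : @tangent R XY (x, y)) (F : cinf XY) :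
  (forall x', F (x', y) = 0) -> (forall y', F (x, y') = 0) -> w F = 0.
Proof.
move=> F1 F2; have [c Ac cx] := atlas_cover x; have [d Ad dy] := atlas_cover y.
pose e : chart R XY (mdim XY) := prod_chart c d.
have Ae : atlas e by exists c, d.
have exy : chart_dom e (x, y) by [].
have [phi [N [_ Nxy _ H]]] := tangent_chart Ae exy.
rewrite (H _ w F Nxy) big1 // => i _; rewrite [partial _ _ _ _](_ : _ = 0) ?mulr0 //.
have Z (r : XY -> R) : (forall x', r (x', y) = 0) -> (forall y', r (x, y') = 0) ->
    real_partial e i r (x, y) = 0.
  move=> r1 r2; rewrite -(splitK i); case: (fintype.split i) => j /=.
    rewrite real_partial_prod_l // (_ : (fun z => _) = cst 0); last exact/funext.
    exact: derive_cst.
  rewrite real_partial_prod_r // (_ : (fun z => _) = cst 0); last exact/funext.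
  exact: derive_cst.
by rewrite /partial !Z // => z; rewrite ?F1 ?F2.
Qed.

(** F minus its two slices, up to a constant, vanishes on both slices. *)
Lemma tangent_prod x y (w : @tangent R XY (x, y)) (F : cinf XY) :
  w F = w (pull_fun (smap_fst X Y) (slice_l F y)) +
        w (pull_fun (smap_snd X Y) (slice_r F x)).
Proof.
rewrite -tangentD; apply/eqP; rewrite -subr_eq0 -tangentB.
rewrite -[X in w X](subrK (cinf_cst XY (- F (x, y)))) tangentD tangent_cst addr0.
apply/eqP; apply: tangent_prod_eq0 => [x'|y'].
  rewrite -[LHS]/(F (x', y) - (F (x', y) + F (x, y)) - - F (x, y)); ring.
rewrite -[LHS]/(F (x, y') - (F (x, y) + F (x, y')) - - F (x, y)); ring.
Qed.

(** In coordinates the value is a sum of terms V (phi_i) times partial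
derivatives of F in the second variable, and the latter are partial
derivatives on the product. *)
Lemma smooth_field_slice (V : forall y : Y, tangent y) (F : cinf XY) :
  smooth_field V -> smooth_cfun (fun p : XY => V p.2 (slice_r F p.1)).
Proof.
move=> sV; apply: csmooth_local => -[x0 y0] _.
have [c Ac cx0] := atlas_cover x0; have [d Ad dy0] := atlas_cover y0.
have [phi [N [oN Ny0 Nd H]]] := tangent_chart Ad dy0.
pose e : chart R XY (mdim XY) := prod_chart c d.
have Ae : atlas e by exists c, d.
have oe : open (chart_dom e) by exact: chart_dom_open.
pose O : set XY := chart_dom e `&` (smap_snd X Y) @^-1` N.
have oO : open O.
  by apply: open_preim => // p _; exact: ((smapP (smap_snd X Y)).1 p I).
exists O; first by split.
apply: (@csmooth_eq R XY O (fun p : XY =>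
  \sum_i V p.2 (phi i) * partial e (rshift _ i : 'I_(mdim XY)) F p)) => //.
  move=> [x y] [[/= cx dy] /= Ny]; rewrite (H _ _ _ Ny); apply: eq_bigr => i _.
  by congr (_ * _); rewrite /partial !real_partial_prod_r.
apply: csmooth_sum => // i; apply: csmoothM => //.
  by have := smooth_cfun_comp (smap_snd X Y) (sV (phi i)); exact: csmooth_sub.
apply: (@csmooth_sub R XY _ (chart_dom e)); first by move=> p [].
by apply: csmooth_partial => //; exact: cinfP.
Qed.
End Product_tangent.

(** * Fibres of a principal bundle *)

Lemma smooth_map_on_pair (R : realType) (X Y Z : manifold R) (U : set X)
    (f : X -> Y) (g : X -> Z) : smooth_map_on U f -> smooth_map_on U g ->
  smooth_map_on (Y := prod_manifold Y Z) U (fun x => (f x, g x)).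
Proof.
move=> [fc sf] [gc sg]; split=> [x Ux|e [c [d [Ac Ad ->]]] j].
  exact: (cvg_pair (fc x Ux) (gc x Ux)).
rewrite -(splitK j); case: (fintype.split j) => i /=.
  rewrite (_ : (fun x => _) = (fun x => c (f x) 0 i)); last first.
    by apply/funext => x; exact: row_mxEl.
  by apply: smooth_fun_sub (sf c Ac i) => x [? [/= ? ?]].
rewrite (_ : (fun x => _) = (fun x => d (g x) 0 i)); last first.
  by apply/funext => x; exact: row_mxEr.
by apply: smooth_fun_sub (sg d Ad i) => x [? [/= ? ?]].
Qed.

Lemma smooth_map_on_sub (R : realType) (X Y : manifold R) (U V : set X) (f : X -> Y) :
  U `<=` V -> smooth_map_on V f -> smooth_map_on U f.
Proof.
move=> UV [fc sf]; split=> [x /UV|d Ad j]; first exact: fc.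
by apply: smooth_fun_sub (sf d Ad j) => x [/UV Vx fx].
Qed.

Section Geometry.
Variables (R : realType) (X M : manifold R) (G : lie_group R).
Variable P : principal_bundle X M G.

Lemma lie_mulKg (g h : G) : lie_mul G (lie_inv G g, lie_mul G (g, h)) = h.
Proof. by rewrite lie_mulA lie_mulVg lie_mul1g. Qed.

Lemma lie_invK (g : G) : lie_inv G (lie_inv G g) = g.
Proof.
by rewrite -[LHS](lie_mulg1) -(lie_mulVg g) lie_mulA lie_mulVg lie_mul1g.
Qed.

Lemma open_smap_preim (Y Z : manifold R) (f : smap Y Z) (A : set Z) :
  open A -> open (f @^-1` A).
Proof.
move=> oA; rewrite -[X in open X]setTI; apply: open_preim => //; first exact: openT.
by move=> x _; exact: ((smapP f).1 x I).
Qed.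

Lemma trivialization_act (U : set M) (s : prod_manifold M G -> X) (t : X -> G) :
  (forall b g, U b -> proj P (s (b, g)) = b /\ t (s (b, g)) = g) ->
  (forall x, U (proj P x) -> s (proj P x, t x) = x) ->
  (forall b g h, U b -> s (b, lie_mul G (g, h)) = act P (s (b, g), h)) ->
  forall x g, U (proj P x) -> t (act P (x, g)) = lie_mul G (t x, g).
Proof.
move=> H1 H2 H3 x g Ux; rewrite -{1}(H2 x Ux) -H3 //.
by case: (H1 (proj P x) (lie_mul G (t x, g)) Ux).
Qed.

(** The action is free because, in a local trivialization, it is right
multiplication in the group. *)
Lemma act_free x (g h : G) : act P (x, g) = act P (x, h) -> g = h.
Proof.
have [U [_ Ux [s [t [_ _ H1 H2 H3]]]]] := local_triviality P (proj P x).
move=> E; have T := trivialization_act H1 H2 H3.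
by rewrite -(lie_mulKg (t x) g) -T // E T // lie_mulKg.
Qed.

Lemma act_transitive x y : proj P y = proj P x -> exists g, act P (x, g) = y.
Proof.
move=> yx; have [U [_ Ux [s [t [_ _ H1 H2 H3]]]]] := local_triviality P (proj P x).
exists (lie_mul G (lie_inv G (t x), t y)).
rewrite -{1}(H2 x Ux) -H3 // lie_mulA lie_mulgV lie_mul1g -yx.
by apply: H2; rewrite yx.
Qed.

Lemma translation_act x g : translation P x (act P (x, g)) = g.
Proof.
by rewrite /translation; case: xgetP => [h _ /act_free //|/(_ g)]; case.
Qed.

Lemma act_translation x y : proj P y = proj P x -> act P (x, translation P x y) = y.
Proof. by move=> /act_transitive[g <-]; rewrite translation_act. Qed.

Lemma vertical_pull x (v : tangent x) b : vertical P v -> v (pull_fun (proj P) b) = 0.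
Proof. by move=> vv; rewrite -[LHS]/(tmap (proj P) v b) vv. Qed.

(** In a local trivialization v becomes a vector of the product M x G without
component along M; by [tangent_prod] it differentiates along the slice
{m} x G only, that is, along the fibre. *)
Lemma vertical_eq0 x (v : tangent x) (f : cinf X) : vertical P v ->
  (forall y, proj P y = proj P x -> f y = 0) -> v f = 0.
Proof.
move=> vv f0.
have [U [oU Ux [s [t [ss st H1 H2 H3]]]]] := local_triviality P (proj P x).
have [chi [schi [N [oN Nx chi1]] [W [oW WU chi0]]]] := plateau_exists oU Ux.
have opU : open (proj P @^-1` U) by exact: open_smap_preim.
have opW : open (proj P @^-1` W) by exact: open_smap_preim.
have schiP : smooth_fun_on setT (chi \o proj P).
  by apply: smooth_fun_sub (smooth_fun_comp openT openT (smapP (proj P)) schi).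
have spt : smooth_map_on (Y := prod_manifold M G) (proj P @^-1` U)
    (fun y => (proj P y, t y)).
  by apply: smooth_map_on_pair st; apply: smooth_map_on_sub (smapP (proj P)).
have sB (F : cinf (prod_manifold M G)) :
    smooth_cfun (fun y => (chi (proj P y))%:C%C * F (proj P y, t y)).
  apply: (csmooth_cut opU opW _ _ schiP) => [y|y|]; [exact: WU|exact: chi0|].
  exact: (csmooth_comp opU openT spt (cinfP F)).
(* B F is F read on X through the trivialization, cut off by chi. *)
pose B F := to_cinf (sB F).
have nearx : \near x, chi (proj P x) = 1.
  have : nbhs x (proj P @^-1` N) by apply: open_nbhs_nbhs; split=> //; exact: open_smap_preim.
  by apply: filterS => y /chi1.
have dw : derivation_at ((proj P x, t x) : prod_manifold M G) (fun F => v (B F)).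
  have Bx F : B F x = F (proj P x, t x) by rewrite /= (nbhs_singleton nearx) mul1r.
  split=> [a F1 F2|F1 F2].
    rewrite -tangentZ -tangentD; congr (v _); apply: cinf_ext => y.
    rewrite -[LHS]/((chi (proj P y))%:C%C * (a * F1 (proj P y, t y) + F2 (proj P y, t y))).
    rewrite -[RHS]/(a * ((chi (proj P y))%:C%C * F1 (proj P y, t y)) +
      (chi (proj P y))%:C%C * F2 (proj P y, t y)); ring.
  rewrite -!Bx -tangentM; apply: tangent_local; apply: filterS nearx => y c1.
  rewrite -[LHS]/((chi (proj P y))%:C%C * (F1 (proj P y, t y) * F2 (proj P y, t y))).
  rewrite -[RHS]/(((chi (proj P y))%:C%C * F1 (proj P y, t y)) *
      ((chi (proj P y))%:C%C * F2 (proj P y, t y))).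
  by rewrite c1 !mul1r.
pose w := to_tangent dw.
have sF : smooth_cfun (fun p : prod_manifold M G => (chi p.1)%:C%C * f (s p)).
  have ofU : open (smap_fst M G @^-1` U) by exact: open_smap_preim.
  have ofW : open (smap_fst M G @^-1` W) by exact: open_smap_preim.
  have sc : smooth_fun_on setT (chi \o smap_fst M G).
    by apply: smooth_fun_sub (smooth_fun_comp openT openT (smapP (smap_fst M G)) schi).
  apply: (csmooth_cut ofU ofW _ _ sc) => [p|p|]; [exact: WU|exact: chi0|].
  apply: (csmooth_comp ofU openT _ (cinfP f)) => //.
  by apply: smooth_map_on_sub ss => p; split.
(* F is f read on the product, cut off by chi. *)
pose F := to_cinf sF.
have -> : v f = w F.
  rewrite -[RHS]/(v (B F)); apply: tangent_local.
  have nU : nbhs x (proj P @^-1` U) by apply: open_nbhs_nbhs.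
  apply: filterS2 nearx nU => y c1 Uy.
  rewrite -[RHS]/((chi (proj P y))%:C%C * ((chi (proj P y))%:C%C * f (s (proj P y, t y)))).
  by rewrite c1 !mul1r H2.
rewrite tangent_prod.
have -> : slice_r F (proj P x) = 0.
  apply: cinf_ext => g.
  rewrite -[LHS]/((chi (proj P x))%:C%C * f (s (proj P x, g))).
  by rewrite f0 ?mulr0 //; case: (H1 _ g Ux).
have -> : pull_fun (smap_snd M G) (0 : cinf G) = 0 by exact: cinf_ext.
rewrite tangent0 addr0.
rewrite -[LHS]/(v (B (pull_fun (smap_fst M G) (slice_l F (t x))))).
rewrite -(vertical_pull (slice_l F (t x)) vv); apply: tangent_local.
apply: filterS nearx => y c1.
rewrite -[LHS]/((chi (proj P y))%:C%C * (slice_l F (t x)) (proj P y)).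
by rewrite c1 mul1r.
Qed.

Lemma vertical_ext x (v : tangent x) (f f' : cinf X) : vertical P v ->
  (forall y, proj P y = proj P x -> f y = f' y) -> v f = v f'.
Proof.
move=> vv ff'; apply/eqP; rewrite -subr_eq0 -tangentB; apply/eqP.
by apply: vertical_eq0 => // y /ff' E; rewrite -[LHS]/(f y - f' y) E subrr.
Qed.

(** Over a trivializing open set tau(x, y) = t(x)^-1 t(y), where t is the group
component; cut off, h of it is a smooth function K of both variables.  The
same K serves for all x near x0, which gives smoothness in x. *)
Lemma translation_extension (h : cinf G) (x0 : X) :
  exists (K : cinf (prod_manifold X X)) (N : set X), [/\ open N, N x0 &
    forall x y, N x -> proj P y = proj P x -> slice_r K x y = h (translation P x y)].
Proof.
have [U [oU Ux [s [t [ss st H1 H2 H3]]]]] := local_triviality P (proj P x0).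
have T := trivialization_act H1 H2 H3.
have [chi [schi [N [oN Nx chi1]] [W [oW WU chi0]]]] := plateau_exists oU Ux.
pose XX := prod_manifold X X.
pose p1 : smap XX M := smap_comp (proj P) (smap_fst X X).
pose p2 : smap XX M := smap_comp (proj P) (smap_snd X X).
pose U2 : set XX := p1 @^-1` U `&` p2 @^-1` U.
pose W2 : set XX := p1 @^-1` W `|` p2 @^-1` W.
have oU2 : open U2 by apply: openI; exact: open_smap_preim.
have oW2 : open W2 by apply: openU; exact: open_smap_preim.
have sc (p : smap XX M) : smooth_fun_on setT (chi \o p).
  by apply: smooth_fun_sub (smooth_fun_comp openT openT (smapP p) schi).
have schi2 := smooth_funM openT (sc p1) (sc p2).
have st2 : smooth_map_on (Y := prod_manifold G G) U2 (fun p => (t p.1, t p.2)).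
  have oPU : open (proj P @^-1` U) by exact: open_smap_preim.
  apply: smooth_map_on_pair.
    apply: (@smooth_map_comp R XX X G U2 _ fst t oU2 oPU) => //; first by move=> p [].
    by apply: smooth_map_on_sub (smapP (smap_fst X X)).
  apply: (@smooth_map_comp R XX X G U2 _ snd t oU2 oPU) => //; first by move=> p [].
  by apply: smooth_map_on_sub (smapP (smap_snd X X)).
pose div : smap (prod_manifold G G) G := smap_comp (lie_mul G)
  (smap_pair (smap_comp (lie_inv G) (smap_fst G G)) (smap_snd G G)).
have sK : smooth_cfun (fun p : XX => ((chi \o p1) p * (chi \o p2) p)%:C%C *
    h (lie_mul G (lie_inv G (t p.1), t p.2))).
  apply: (csmooth_cut oU2 oW2 _ _ schi2) => [p|p|].
  - have [?|?] := WU (p1 p); first by left; left.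
    by have [?|?] := WU (p2 p); [left; right|right].
  - by move=> [] /chi0 /= ->; rewrite ?mul0r ?mulr0.
  - exact: (csmooth_comp oU2 openT st2 (smooth_cfun_comp div (cinfP h))).
exists (to_cinf sK), (proj P @^-1` N); split => //; first exact: open_smap_preim.
move=> x y Nxx yx.
rewrite -[LHS]/((chi (proj P x) * chi (proj P y))%:C%C * h (lie_mul G (lie_inv G (t x), t y))).
rewrite yx !chi1 // !mul1r; congr (h _).
have Uxx : U (proj P x).
  by have [/chi0|//] := WU (proj P x); rewrite chi1 // => /eqP; rewrite oner_eq0.
by have [g <-] := act_transitive yx; rewrite T // lie_mulKg translation_act.
Qed.

Lemma translation_extends (h : cinf G) x : exists f : cinf X,
  forall y, proj P y = proj P x -> f y = h (translation P x y).
Proof.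
have [K [N [_ Nx H]]] := translation_extension h x.
by exists (slice_r K x) => y; exact: H.
Qed.
End Geometry.

(** * Pull-backs and the action of gauge transformations *)

Section Pull.
Variable R : realType.

Section General.
Variables (X Y : manifold R) (f : diffeo X Y).

Lemma pull_formD a b : pull_form f (a + b) = pull_form f a + pull_form f b.
Proof. exact: form_ext. Qed.
Lemma pull_formZ k a : pull_form f (k *: a) = pull_fun f k *: pull_form f a.
Proof. exact: form_ext. Qed.
Lemma pull_formN a : pull_form f (- a) = - pull_form f a.
Proof. exact: form_ext. Qed.
Lemma pull_form_d h : pull_form f (form_d h) = form_d (pull_fun f h).
Proof. exact: form_ext. Qed.
Lemma pull_funD h k : pull_fun f (h + k) = pull_fun f h + pull_fun f k.
Proof. exact: cinf_ext. Qed.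
Lemma pull_funM h k : pull_fun f (h * k) = pull_fun f h * pull_fun f k.
Proof. exact: cinf_ext. Qed.
Lemma pull_fun_cst c : pull_fun f (cinf_cst Y c) = cinf_cst X c.
Proof. exact: cinf_ext. Qed.
Lemma pull_form_K a : pull_form (diffeo_inv f) (pull_form f a) = a.
Proof.
apply: form_ext => x v /=; apply: form_congr => [|h]; first exact: (dinvK f).
by rewrite /=; congr (v _); apply: cinf_ext => y /=; rewrite (dinvK f).
Qed.
Lemma pull_form_VK a : pull_form f (pull_form (diffeo_inv f) a) = a.
Proof.
apply: form_ext => x v /=; apply: form_congr => [|h]; first exact: (dfunK f).
by rewrite /=; congr (v _); apply: cinf_ext => y /=; rewrite (dfunK f).
Qed.
Lemma pull_fun_K h : pull_fun (diffeo_inv f) (pull_fun f h) = h.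
Proof. by apply: cinf_ext => y /=; rewrite (dinvK f). Qed.
End General.

Lemma pull_form_comm (X : manifold R) (f g : diffeo X X) a :
  (forall x, f (g x) = g (f x)) ->
  pull_form f (pull_form g a) = pull_form g (pull_form f a).
Proof.
move=> fg; apply: form_ext => x v /=; apply: form_congr => [|h]; first by rewrite /= fg.
by rewrite /=; congr (v _); apply: cinf_ext => y; rewrite /= fg.
Qed.
End Pull.

Section Actions.
Variables (R : realType) (X M : manifold R) (G : lie_group R).
Variable P : principal_bundle X M G.
Implicit Types (c d : gauge P) (g : G).

Lemma vertical_tmap (f : diffeo X X) x (v : tangent x) :
  (forall x, proj P (f x) = proj P x) -> vertical P v -> vertical P (tmap f v).
Proof.
move=> pf vv; apply: tangent_ext => b /=; rewrite -[RHS]/(0 : R[i]).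
rewrite -(vertical_pull b vv); congr (v _); apply: cinf_ext => y /=.
by rewrite pf.
Qed.

Lemma horizontal_pull (f : diffeo X X) a : (forall x, proj P (f x) = proj P x) ->
  horizontal P a -> horizontal P (pull_form f a).
Proof. by move=> pf ha x v vv; apply: ha; exact: vertical_tmap. Qed.

Lemma gauge_pull_Rg c g a :
  pull_form c (pull_form (Rg P g) a) = pull_form (Rg P g) (pull_form c a).
Proof. by apply: pull_form_comm => x; exact: gauge_act. Qed.

Lemma gauge_pull_fun_Rg c g f :
  pull_fun c (pull_fun (Rg P g) f) = pull_fun (Rg P g) (pull_fun c f).
Proof. by apply: cinf_ext => x; rewrite /= gauge_act. Qed.

(** A vertical automorphism and its inverse both preserve vertical vectors. *)
Lemma horizontal_gauge c a : horizontal P (pull_form c a) <-> horizontal P a.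
Proof.
split=> H; last by apply: horizontal_pull => //; exact: gauge_proj.
by rewrite -(pull_form_K c a); apply: (horizontal_pull (f := gauge_inv c)) => //;
  exact: gauge_proj.
Qed.

Lemma gauge_pull_Rg_inv c g a : pull_form (diffeo_inv c) (pull_form (Rg P g) a) =
  pull_form (Rg P g) (pull_form (diffeo_inv c) a).
Proof. exact: (gauge_pull_Rg (gauge_inv c)). Qed.

Lemma connections_gauge c Pi : connections P Pi -> connections P (gauge_P P c Pi).
Proof.
case=> lPi idem ker eqv; split.
- move=> k a b; rewrite /gauge_P /= pull_formD pull_formZ lPi pull_formD pull_formZ.
  by rewrite pull_fun_K.
- by move=> a; rewrite /gauge_P /= pull_form_VK idem.
- move=> a; rewrite -(horizontal_gauge c) -ker /gauge_P /=; split=> [E|->].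
    rewrite -(pull_form_VK c (Pi (pull_form c a))) E; exact: form_ext.
  exact: form_ext.
- by move=> g a; rewrite /gauge_P /= gauge_pull_Rg eqv gauge_pull_Rg_inv.
Qed.

Lemma connection_forms_gauge c w :
  connection_forms P w -> connection_forms P (gauge_F P c w).
Proof.
case=> lw Lw w1 eqv; split.
- move=> k f g; rewrite /gauge_F /= lw pull_formD pull_formZ pull_fun_cst //.
- by move=> h1 h2; rewrite /gauge_F /= Lw pull_formD !pull_formZ !pull_fun_cst.
- move=> x h v; rewrite -(w1 (diffeo_inv c x)) /gauge_F /=.
  apply: form_congr => [|f]; first exact: (gauge_act (gauge_inv c)).
  rewrite /=; congr (v _); apply: cinf_ext => k /=.
  by rewrite [dinv c _](gauge_act (gauge_inv c)).
- by move=> g h; rewrite /gauge_F /= -gauge_pull_Rg_inv eqv.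
Qed.

Lemma covariant_differentiations_gauge c D :
  covariant_differentiations P D -> covariant_differentiations P (gauge_D P c D).
Proof.
case=> [[lD hD] LD Db eqv]; split.
- split=> [k f g|f].
    rewrite /gauge_D /= pull_funD pull_funM pull_fun_cst lD pull_formD pull_formZ.
    by rewrite pull_fun_cst.
  by apply: (horizontal_pull (f := gauge_inv c)) => //; exact: gauge_proj.
- move=> f g; rewrite /gauge_D /= pull_funM LD pull_formD !pull_formZ.
  by rewrite !pull_fun_K.
- move=> b; rewrite /gauge_D /=.
  have pb (d : gauge P) : pull_fun d (pull_fun (proj P) b) = pull_fun (proj P) b.
    by apply: cinf_ext => x /=; rewrite gauge_proj.
  by rewrite pb -Db pull_form_d (pb (gauge_inv c)).
- move=> g f; rewrite /gauge_D /= -gauge_pull_Rg_inv eqv.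
  by rewrite gauge_pull_fun_Rg.
Qed.

Lemma pull_form_mul c d a : pull_form (c * d)%g a = pull_form d (pull_form c a).
Proof.
by apply: form_ext => x v /=; apply: form_congr => // f; congr (v _); exact: cinf_ext.
Qed.

Lemma pull_form_mul_inv c d a : pull_form (diffeo_inv (c * d)%g) a =
  pull_form (diffeo_inv c) (pull_form (diffeo_inv d) a).
Proof.
by apply: form_ext => x v /=; apply: form_congr => // f; congr (v _); exact: cinf_ext.
Qed.

Lemma pull_form_one a : pull_form (1 : gauge P)%g a = a.
Proof.
by apply: form_ext => x v /=; apply: form_congr => // f; congr (v _); exact: cinf_ext.
Qed.

Lemma pull_form_one_inv a : pull_form (diffeo_inv (1 : gauge P)%g) a = a.
Proof.
by apply: form_ext => x v /=; apply: form_congr => // f; congr (v _); exact: cinf_ext.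
Qed.

Lemma gauge_acts_P : gauge_acts (connections P) (gauge_P P).
Proof.
split=> [c Pi|Pi _|c d Pi _]; first exact: connections_gauge.
  by apply/funext => a; rewrite /gauge_P /= pull_form_one pull_form_one_inv.
by apply/funext => a; rewrite /gauge_P /= pull_form_mul pull_form_mul_inv.
Qed.

Lemma gauge_acts_F : gauge_acts (connection_forms P) (gauge_F P).
Proof.
split=> [c w|w _|c d w _]; first exact: connection_forms_gauge.
  by apply/funext => a; rewrite /gauge_F /= pull_form_one_inv.
by apply/funext => a; rewrite /gauge_F /= pull_form_mul_inv.
Qed.

Lemma gauge_acts_D : gauge_acts (covariant_differentiations P) (gauge_D P).
Proof.
split=> [c D|D _|c d D _]; first exact: covariant_differentiations_gauge.
  apply/funext => f; rewrite /gauge_D /= pull_form_one_inv.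
  by congr (D _); exact: cinf_ext.
apply/funext => f; rewrite /gauge_D /= pull_form_mul_inv.
by congr (pull_form _ (pull_form _ (D _))); exact: cinf_ext.
Qed.
End Actions.

(** * Affine combinations *)

Section Affine.
Variables (R : realType) (X M : manifold R) (G : lie_group R).
Variable P : principal_bundle X M G.
Variable c : R[i].
Local Notation k1 := (cinf_cst X (1 - c)).
Local Notation k2 := (cinf_cst X c).

Let k12 : k1 + k2 = 1.
Proof. by apply: cinf_ext => x; rewrite -[LHS]/(1 - c + c) subrK. Qed.

(** The projections have the same kernel, and Pi2 a - a lies in it.  This makes
affine combinations of them idempotent. *)
Lemma connections_absorb Pi1 Pi2 a : connections P Pi1 -> connections P Pi2 ->
  Pi1 (Pi2 a) = Pi1 a.
Proof.
move=> [l1 _ ker1 _] [l2 idem2 ker2 _]; apply/eqP; rewrite -subr_eq0 -(linear_formB l1).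
by apply/eqP/ker1/ker2; rewrite (linear_formB l2) idem2 subrr.
Qed.

Lemma connections_affine Pi1 Pi2 : connections P Pi1 -> connections P Pi2 ->
  connections P (affine_comb c Pi1 Pi2).
Proof.
move=> H1 H2; have [l1 idem1 ker1 eqv1] := H1; have [l2 idem2 ker2 eqv2] := H2.
have lin : linear (affine_comb c Pi1 Pi2).
  move=> f a b; rewrite /affine_comb l1 l2; apply: form_ext => x v; rewrite !formE; ring.
split=> //.
- move=> a; rewrite /affine_comb (linear_formD l1) (linear_formD l2).
  rewrite !(linear_formZ l1) !(linear_formZ l2) idem1 idem2.
  by rewrite (connections_absorb _ H1 H2) (connections_absorb _ H2 H1) -!scalerDl k12 !scale1r.
- move=> a; split=> [E|ha].
    apply/ker1; have := congr1 Pi1 E; rewrite /affine_comb (linear_formD l1) !(linear_formZ l1).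
    by rewrite idem1 (connections_absorb _ H1 H2) -scalerDl k12 scale1r (linear_form0 l1).
  by rewrite /affine_comb (ker1 a).2 // (ker2 a).2 // !scaler0 addr0.
- move=> g a; rewrite /affine_comb eqv1 eqv2 pull_formD !pull_formZ.
  by rewrite !pull_fun_cst.
Qed.

Lemma connection_forms_affine w1 w2 : connection_forms P w1 -> connection_forms P w2 ->
  connection_forms P (affine_comb c w1 w2).
Proof.
move=> [l1 L1 e1 eqv1] [l2 L2 e2 eqv2]; split.
- by move=> k f g; rewrite /affine_comb l1 l2; apply: form_ext => x v; rewrite !formE; ring.
- by move=> f g; rewrite /affine_comb L1 L2; apply: form_ext => x v; rewrite !formE; ring.
- move=> x h v; rewrite /affine_comb !formE e1 e2 !formE.
  by rewrite -mulrDl -[_ + _]/(1 - c + c) subrK mul1r.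
- move=> g h; rewrite /affine_comb pull_formD !pull_formZ eqv1 eqv2.
  by rewrite !pull_fun_cst.
Qed.

Lemma covariant_differentiations_affine D1 D2 :
  covariant_differentiations P D1 -> covariant_differentiations P D2 ->
  covariant_differentiations P (affine_comb c D1 D2).
Proof.
move=> [[l1 h1] L1 b1 eqv1] [[l2 h2] L2 b2 eqv2]; split.
- split=> [k f g|f x v vv].
    by rewrite /affine_comb l1 l2; apply: form_ext => x v; rewrite !formE; ring.
  by rewrite /affine_comb !formE h1 // h2 // !mulr0 addr0.
- by move=> f g; rewrite /affine_comb L1 L2; apply: form_ext => x v; rewrite !formE; ring.
- by move=> b; rewrite /affine_comb -b1 -b2 -scalerDl k12 scale1r.
- move=> g h; rewrite /affine_comb pull_formD !pull_formZ eqv1 eqv2.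
  by rewrite !pull_fun_cst.
Qed.
End Affine.

(** Reduces an isomorphism defined by a formula to properties of the formula as
a relation.  Affinity and equivariance of the map follow from those of the
relation, the solution being unique. *)
Lemma iso_of_relation (R : realType) (X M : manifold R) (G : lie_group R)
    (P : principal_bundle X M G) (S T : Type)
    (A : set (S -> form X)) (B : set (T -> form X))
    (opA : gauge P -> (S -> form X) -> (S -> form X))
    (opB : gauge P -> (T -> form X) -> (T -> form X))
    (formula : (S -> form X) -> (T -> form X) -> Prop) :
  (forall u, A u -> exists2 v, B v & formula u v) ->
  (forall u v v', A u -> formula u v -> formula u v' -> v = v') ->
  (forall v, B v -> exists2 u, A u & formula u v) ->
  (forall u u' v, A u -> A u' -> formula u v -> formula u' v -> u = u') ->
  (forall c u u', A u -> A u' -> A (affine_comb c u u')) ->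
  (forall c u u' v v', A u -> A u' -> formula u v -> formula u' v' ->
    formula (affine_comb c u u') (affine_comb c v v')) ->
  (forall c u, A u -> A (opA c u)) ->
  (forall c u v, A u -> formula u v -> formula (opA c u) (opB c v)) ->
  defines_equivariant_affine_iso A B opA opB formula.
Proof.
move=> ex uniq_ surj inj Aaff faff Aop fop.
(* Outside A the map takes an arbitrary value. *)
pose j u := xget (fun=> 0) [set v | formula u v].
have jP u : A u -> formula u (j u) by move=> /ex [v _]; exact: xgetI.
have jE u v : A u -> formula u v -> v = j u by move=> Au uv; apply: uniq_ (jP u Au).
exists j; split.
- by move=> u Au; split=> [|v]; [exact: jP|exact: jE].
- split.
  + by move=> u Au; have [v Bv /(jE _ _ Au) <-] := ex u Au.
  + move=> u u' /set_mem Au /set_mem Au' E.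
    by apply: (inj _ _ _ Au Au' (jP u Au)); rewrite E; exact: jP.
  + by move=> v /surj [u Au uv]; exists u => //; rewrite -(jE u v).
- move=> c u u' Au Au'; split; first exact: Aaff.
  by apply/esym/jE; [exact: Aaff|apply: faff => //; exact: jP].
- by move=> c u Au; apply/esym/jE; [exact: Aop|apply: fop => //; exact: jP].
Qed.

(** * From covariant differentiations to connections *)

Section Isomorphisms.
Variables (R : realType) (X M : manifold R) (G : lie_group R).
Variable P : principal_bundle X M G.
Implicit Types (D : cinf X -> form X) (Pi : form X -> form X) (w : cinf G -> form X).

Section Connection_of_differentiation.
Variables (D : cinf X -> form X).
Hypothesis HD : covariant_differentiations P D.

Fact hor_derivation x (Y : tangent x) : derivation_at x (fun f => D f x Y).
Proof.
have [[lD _] LD _ _] := HD; split=> [k f g|f g]; first by rewrite lD !formE.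
by rewrite LD !formE mulrC.
Qed.

Definition hor x (Y : tangent x) : tangent x := to_tangent (hor_derivation Y).

(** This is the condition db = Db for functions b on the base. *)
Lemma vertical_sub_hor x (Y : tangent x) : vertical P (Y - hor Y).
Proof.
have [_ _ Db _] := HD; apply: tangent_ext => b.
by rewrite -[LHS]/(form_d _ x Y - D _ x Y) Db subrr.
Qed.

(** This is horizontality of the forms D f. *)
Lemma hor_vertical x (v : tangent x) : vertical P v -> hor v = 0.
Proof. by have [[_ hD] _ _ _] := HD; move=> vv; apply: tangent_ext => f; exact: hD. Qed.

Lemma horB x (u v : tangent x) : hor (u - v) = hor u - hor v.
Proof. by apply: tangent_ext => f; exact: form_valB. Qed.

Fact connection_of_linear (a : form X) x : scalar (fun Y : tangent x => a x (Y - hor Y)).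
Proof.
move=> k u v; rewrite -form_linear; congr (a x _); apply: tangent_ext => f.
rewrite -[LHS]/(k * u f + v f - D f x (k *: u + v)) form_linear.
rewrite -[RHS]/(k * (u f - D f x u) + (v f - D f x v)); ring.
Qed.

Fact connection_of_smooth (a : form X) (V : forall x : X, tangent x) :
  smooth_field V -> smooth_cfun (fun x => a x (V x - hor (V x))).
Proof.
move=> sV; have sh : smooth_field (fun x => hor (V x)).
  by move=> f; exact: (form_smooth (D f) sV).
have := cinfP (to_cinf (form_smooth a sV) - to_cinf (form_smooth a sh)).
by congr smooth_cfun; apply/funext => x; rewrite form_valB.
Qed.

Definition connection_of (a : form X) : form X :=
  Form (connection_of_linear a) (@connection_of_smooth a).

Lemma connection_ofE a x (Y : tangent x) : connection_of a x Y = a x (Y - hor Y).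
Proof. by []. Qed.

Lemma connection_of_formula : Pi_formula D connection_of.
Proof.
split=> [k a b|f]; first by apply: form_ext => x Y; rewrite !formE !connection_ofE !formE.
by apply: form_ext => x Y.
Qed.

(** Y |-> Y - hor Y is a projection onto the vertical vectors, being the
identity on them; Pi is its transpose.  So Pi is idempotent and its kernel
consists of the forms that vanish on vertical vectors. *)
Lemma connection_ofP : connections P connection_of.
Proof.
have [_ _ _ eqv] := HD; split.
- by have [] := connection_of_formula.
- move=> a; apply: form_ext => x Y; rewrite !connection_ofE horB.
  by rewrite -horB (hor_vertical (vertical_sub_hor Y)) subr0.
- move=> a; split=> [E x v vv|ha].
    by have := congr1 (fun b : form X => b x v) E; rewrite connection_ofE hor_vertical // subr0.
  by apply: form_ext => x Y; rewrite connection_ofE; apply: ha; exact: vertical_sub_hor.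
- move=> g a; apply: form_ext => x Y /=; congr (a _ _); apply: tangent_ext => f /=.
  rewrite -[LHS]/(Y (pull_fun (Rg P g) f) - D (pull_fun (Rg P g) f) x Y).
  by rewrite -eqv.
Qed.
End Connection_of_differentiation.

Lemma Pi_formula_unique D Pi Pi' : Pi_formula D Pi -> Pi_formula D Pi' -> Pi = Pi'.
Proof.
by move=> [l E] [l' E']; apply: linear_form_ext => // f; rewrite E E'.
Qed.

Lemma Pi_formula_connections D Pi : covariant_differentiations P D ->
  Pi_formula D Pi -> connections P Pi.
Proof.
by move=> HD F; rewrite (Pi_formula_unique F (connection_of_formula HD)); exact: connection_ofP.
Qed.

(** D f = df - Pi (df) is horizontal because Pi is idempotent with kernel the
horizontal forms, and Db = db because db is horizontal. *)
Lemma Pi_formula_surj Pi : connections P Pi ->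
  exists2 D, covariant_differentiations P D & Pi_formula D Pi.
Proof.
move=> [l idem ker eqv]; exists (fun f => form_d f - Pi (form_d f)); last first.
  by split=> // f; rewrite opprB addrC subrK.
split.
- split=> [k f g|f].
    rewrite form_dD form_dZ (linear_formD l) (linear_formZ l).
    by apply: form_ext => x v; rewrite !formE; ring.
  by apply/ker; rewrite (linear_formB l) idem subrr.
- move=> f g; rewrite form_dM (linear_formD l) !(linear_formZ l).
  by apply: form_ext => x v; rewrite !formE; ring.
- move=> b; rewrite (ker _).2 ?subr0 // => x v vv; exact: vertical_pull.
- by move=> g f; rewrite pull_formD pull_formN -eqv pull_form_d.
Qed.

Lemma Pi_formula_iso : defines_equivariant_affine_iso
  (covariant_differentiations P) (connections P) (gauge_D P) (gauge_P P) Pi_formula.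
Proof.
apply: iso_of_relation.
- move=> D HD; exists (connection_of HD); first exact: connection_ofP.
  exact: connection_of_formula.
- by move=> D Pi Pi' _; exact: Pi_formula_unique.
- exact: Pi_formula_surj.
- move=> D D' Pi _ _ [_ E] [_ E']; apply/funext => f.
  by apply/oppr_inj/(addrI (form_d f)); rewrite -E -E'.
- exact: covariant_differentiations_affine.
- move=> c D D' Pi Pi' HD HD' F F'.
  have [l _ _ _] := connections_affine c (Pi_formula_connections HD F)
    (Pi_formula_connections HD' F').
  split=> // f; have [[_ E] [_ E']] := (F, F').
  by rewrite /affine_comb E E'; apply: form_ext => x v; rewrite !formE /=; ring.
- exact: covariant_differentiations_gauge.
- move=> c D Pi HD F.
  have [l _ _ _] := connections_gauge c (Pi_formula_connections HD F).
  split=> // f; have [_ E] := F.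
  by rewrite /gauge_P /= pull_form_d E pull_formD pull_formN pull_form_d pull_fun_K.
Qed.

(** * From connections to connection forms *)

Section Form_of_connection.
Variable Pi : form X -> form X.
Hypothesis HPi : connections P Pi.

Fact ver_derivation x (Y : tangent x) : derivation_at x (fun f => Pi (form_d f) x Y).
Proof.
have [l _ _ _] := HPi; split=> [k f g|f g].
  by rewrite form_dD form_dZ l !formE.
by rewrite form_dM (linear_formD l) !(linear_formZ l) !formE mulrC.
Qed.

Definition ver x (Y : tangent x) : tangent x := to_tangent (ver_derivation Y).

Lemma ver_vertical x (Y : tangent x) : vertical P (ver Y).
Proof.
have [_ _ ker _] := HPi; apply: tangent_ext => b.
rewrite -[LHS]/(Pi (form_d (pull_fun (proj P) b)) x Y) (ker _).2 // => z v.
exact: vertical_pull.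
Qed.

(** Pi (df) - df is killed by Pi, hence horizontal. *)
Lemma ver_id x (v : tangent x) : vertical P v -> ver v = v.
Proof.
have [l idem ker _] := HPi; move=> vv; apply: tangent_ext => f; apply/eqP.
rewrite -subr_eq0; apply/eqP.
have /ker H : Pi (Pi (form_d f) - form_d f) = 0.
  by rewrite (linear_formB l) idem subrr.
exact: H x v vv.
Qed.

(** Since [ver Y] is determined by its values on functions, the existential
vector disappears; and any extension of h o tau(x, .) may be used. *)
Lemma omega_formulaE w : omega_formula P Pi w <->
  forall (h : cinf G) (x : X) (Y : tangent x) (f : cinf X),
    (forall y, proj P y = proj P x -> f y = h (translation P x y)) ->
    w h x Y = ver Y f.
Proof.
split=> [F h x Y f fh|F h x Y].
  by have [V [verV _ [_ /(_ f fh) <-]]] := F h x Y; rewrite verV.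
exists (ver Y); split=> //; first exact: ver_vertical.
by split=> [|f fh]; [exact: translation_extends|rewrite (F _ _ _ _ fh)].
Qed.

(** An extension of h o tau(x, .) from the fibre of x.  It is chosen for each x
separately, without any regularity in x: by [vertical_ext] the values of
vertical vectors on it do not depend on the choice. *)
Definition fibre_ext (h : cinf G) (x : X) : cinf X :=
  projT1 (cid (translation_extends P h x)).

Lemma fibre_extE h x y : proj P y = proj P x -> fibre_ext h x y = h (translation P x y).
Proof. by rewrite /fibre_ext; case: cid => f /= H; exact: H. Qed.

Fact connection_form_of_linear h x : scalar (fun Y : tangent x => ver Y (fibre_ext h x)).
Proof. by move=> k u v; exact: form_linear. Qed.

(** Near x0 the chosen extensions may be replaced by the slices of one function
of two variables, and then the diagonal of a smooth function results. *)
Fact connection_form_of_smooth h (V : forall x : X, tangent x) :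
  smooth_field V -> smooth_cfun (fun x => ver (V x) (fibre_ext h x)).
Proof.
move=> sV; apply: csmooth_local => x0 _.
have [K [N [oN Nx0 HK]]] := translation_extension P h x0.
exists N => //; pose W x := ver (V x).
have sW : smooth_field W by move=> f; exact: (form_smooth (Pi (form_d f)) sV).
have := smooth_cfun_comp (smap_pair (smap_id X) (smap_id X)) (smooth_field_slice K sW).
move=> /(csmooth_sub (@subsetT _ N)); apply: csmooth_eq => // x Nx.
apply: (vertical_ext (ver_vertical (V x))) => y yx.
by rewrite HK // fibre_extE.
Qed.

Definition connection_form_of h : form X :=
  Form (connection_form_of_linear h) (@connection_form_of_smooth h).

Lemma connection_form_of_formula : omega_formula P Pi connection_form_of.
Proof.
apply/omega_formulaE => h x Y f fh.
by apply: (vertical_ext (ver_vertical Y)) => y yx; rewrite fibre_extE // fh.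
Qed.

Lemma connection_form_ofE (h : cinf G) x (Y : tangent x) (f : cinf X) :
  (forall y, proj P y = proj P x -> f y = h (translation P x y)) ->
  connection_form_of h x Y = ver Y f.
Proof. by move/omega_formulaE: connection_form_of_formula; exact. Qed.

Lemma translation_refl x : translation P x x = lie_one G.
Proof. by rewrite -{2}(act1 P x) translation_act. Qed.

(** Each condition becomes an identity between extensions: sums and products of
extensions extend sums and products, the orbit map turns an extension into h,
and tau(xg, yg) = g^-1 tau(x, y) g. *)
Lemma connection_form_ofP : connection_forms P connection_form_of.
Proof.
have [l _ _ eqv] := HPi; split.
- move=> k h h'; apply: form_ext => x Y; rewrite !formE.
  rewrite (@connection_form_ofE _ _ _ (cinf_cst X k * fibre_ext h x + fibre_ext h' x)).
    by rewrite tangentD tangentZ.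
  move=> y yx; rewrite -[LHS]/(k * fibre_ext h x y + fibre_ext h' x y).
  by rewrite !fibre_extE.
- move=> h h'; apply: form_ext => x Y; rewrite !formE.
  rewrite (@connection_form_ofE _ _ _ (fibre_ext h x * fibre_ext h' x)); last first.
    move=> y yx; rewrite -[LHS]/(fibre_ext h x y * fibre_ext h' x y).
    by rewrite !fibre_extE.
  by rewrite tangentM !fibre_extE // translation_refl mulrC.
- move=> x h v; rewrite formE.
  rewrite -[LHS]/(ver (tmap (Rx P x) v) (fibre_ext h (Rx P x (lie_one G)))).
  rewrite ver_id; last first.
    apply: tangent_ext => b; apply: etrans (tangent_cst v (b (proj P x))).
    by congr (v _); apply: cinf_ext => g /=; rewrite proj_act.
  congr (v _); apply: cinf_ext => g /=.
  by rewrite fibre_extE ?proj_act // act1 translation_act.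
- move=> g h; apply: form_ext => x Y.
  pose f := fibre_ext h (Rg P g x).
  rewrite -[LHS]/(pull_form (Rg P g) (Pi (form_d f)) x Y) -eqv pull_form_d.
  apply/esym/connection_form_ofE => y /act_transitive[k <-]; rewrite translation_act /=.
  rewrite /f fibre_extE; last by rewrite /= !proj_act.
  congr (h _); rewrite lie_invK /=; apply: (@act_free _ _ _ _ P (act P (x, g))).
  rewrite act_translation; last by rewrite !proj_act.
  by rewrite !actM !lie_mulA lie_mulgV lie_mul1g.
Qed.
End Form_of_connection.

(** * From connection forms to covariant differentiations *)

Section Differentiation_of_form.
Variable w : cinf G -> form X.
Hypothesis Hw : connection_forms P w.

Fact form_derivation x (Y : tangent x) : derivation_at (lie_one G) (fun h => w h x Y).
Proof.
have [lw Lw _ _] := Hw; split=> [k h h'|h h']; first by rewrite lw !formE.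
by rewrite Lw !formE /= mulrC.
Qed.
Let wt x (Y : tangent x) := to_tangent (form_derivation Y).

Let orbit f x := pull_fun (Rx P x) f.

Fact differentiation_of_linear f x : scalar (fun Y : tangent x => Y f - w (orbit f x) x Y).
Proof. by move=> k u v; rewrite form_linear -[(k *: u + v) f]/(k * u f + v f); ring. Qed.

(** The argument R_x^* f of w varies with x.  By the frame of G at the unit, w
depends on it through finitely many derivatives at the unit, which are smooth
in x, and the remaining factors w (phi_i) have fixed arguments. *)
Fact differentiation_of_smooth f (V : forall x : X, tangent x) :
  smooth_field V -> smooth_cfun (fun x => V x f - w (orbit f x) x (V x)).
Proof.
move=> sV; pose F := pull_fun (act P) f.
have [chi [n [phi [E [chi1 sE frame]]]]] := local_frame (lie_one G).
have s i := smooth_cfun_comp (smap_pair (smap_id X) (smap_cst X (lie_one G)))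
  (smooth_field_slice F (sE i)).
have := cinfP (to_cinf (sV f) - \sum_i to_cinf (form_smooth (w (phi i)) sV) * to_cinf (s i)).
congr smooth_cfun; apply/funext => x.
rewrite -[LHS]/(V x f - (\sum_i to_cinf (form_smooth (w (phi i)) sV) * to_cinf (s i) : cinf X) x).
congr (_ - _); rewrite -[RHS]mul1r -chi1.
rewrite [RHS](frame _ (wt (V x)) (orbit f x)).
rewrite cinf_sumE; apply: eq_bigr => i _.
rewrite -[LHS]/(w (phi i) x (V x) * E i (lie_one G) (slice_r F x)).
by congr (_ * E i _ _); exact: cinf_ext.
Qed.

Definition differentiation_of f : form X :=
  Form (differentiation_of_linear f) (@differentiation_of_smooth f).

Lemma differentiation_of_formula : D_formula P w differentiation_of.
Proof. by []. Qed.

(** A vertical vector v is the image under the orbit map of the tangent vector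
A of the group which derives h by applying v to an extension of
h o tau(x, .); on such images w is prescribed. *)
Lemma connection_form_vertical x (v : tangent x) f : vertical P v -> w (orbit f x) x v = v f.
Proof.
have [_ _ we _] := Hw; move=> vv.
have vE (f1 f2 : cinf X) := @vertical_ext _ _ _ _ P x v f1 f2 vv.
have dA : derivation_at (lie_one G) (fun h => v (fibre_ext h x)).
  split=> [k h h'|h h'].
    rewrite -tangentZ -tangentD; apply: vE => y yx.
    rewrite -[RHS]/(k * fibre_ext h x y + fibre_ext h' x y).
    by rewrite !fibre_extE.
  have e (k : cinf G) : k (lie_one G) = fibre_ext k x x.
    by rewrite fibre_extE // translation_refl.
  rewrite !e -tangentM; apply: vE => y yx.
  by rewrite -[RHS]/(fibre_ext h x y * fibre_ext h' x y) !fibre_extE.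
pose A := to_tangent dA.
have AE k : A (orbit k x) = v k.
  by apply: vE => y yx; rewrite fibre_extE //= act_translation.
rewrite -AE -[RHS]/(form_d (orbit f x) (lie_one G) A) -(we x).
apply: form_congr => [|k]; first by rewrite /= act1.
by rewrite -AE.
Qed.

Lemma differentiation_ofP : covariant_differentiations P differentiation_of.
Proof.
have [lw Lw _ eqv] := Hw; split.
- split=> [k f g|f x v vv].
    apply: form_ext => x Y; rewrite !formE /= tangentD tangentZ.
    have -> : orbit (cinf_cst X k * f + g) x = cinf_cst G k * orbit f x + orbit g x.
      exact: cinf_ext.
    by rewrite lw !formE /=; ring.
  by rewrite /= connection_form_vertical // subrr.
- move=> f g; apply: form_ext => x Y; rewrite !formE /= tangentM.
  have -> : orbit (f * g) x = orbit f x * orbit g x by exact: cinf_ext.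
  by rewrite Lw !formE /= act1; ring.
- move=> b; apply: form_ext => x Y; rewrite formE /=.
  have -> : orbit (pull_fun (proj P) b) x = cinf_cst G (b (proj P x)).
    by apply: cinf_ext => g /=; rewrite proj_act.
  by rewrite [w _ x Y](tangent_cst (wt Y)) subr0.
- move=> g f; apply: form_ext => x Y.
  rewrite -[LHS]/(Y (pull_fun (Rg P g) f) -
    pull_form (Rg P g) (w (orbit f (Rg P g x))) x Y) eqv /=.
  congr (_ - w _ x Y); apply: cinf_ext => k /=.
  by rewrite lie_invK !actM !lie_mulA lie_mulgV lie_mul1g.
Qed.
End Differentiation_of_form.

(** * The commuting triangle *)

Lemma D_formula_unique w D D' : D_formula P w D -> D_formula P w D' -> D = D'.
Proof. by move=> F F'; apply/funext => f; apply: form_ext => x Y; rewrite F F'. Qed.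

(** Every h is R_x^* f for a suitable f, namely an extension of h o tau(x, .). *)
Lemma D_formula_inj w w' D : D_formula P w D -> D_formula P w' D -> w = w'.
Proof.
move=> F F'; apply/funext => h; apply: form_ext => x Y.
have [f fh] := translation_extends P h x.
have -> : h = pull_fun (Rx P x) f.
  by apply: cinf_ext => g /=; rewrite fh ?proj_act // translation_act.
by apply/oppr_inj/(addrI (Y f)); have := F f x Y; rewrite (F' f x Y).
Qed.

(** As f itself extends (R_x^* f) o tau(x, .), the form w of Pi satisfies
w (R_x^* f) x Y = Pi (df) x Y. *)
Lemma omega_D_formula Pi w D : connections P Pi -> omega_formula P Pi w ->
  Pi_formula D Pi <-> D_formula P w D.
Proof.
move=> HPi /(omega_formulaE HPi) F; have [l _ _ _] := HPi.
have wE f x (Y : tangent x) : w (pull_fun (Rx P x) f) x Y = Pi (form_d f) x Y.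
  by apply: F => y yx; rewrite /= act_translation.
split=> [[_ E] f x Y|E].
  by rewrite !formE wE E !formE opprB addrC subrK.
split=> // f; apply: form_ext => x Y.
by rewrite !formE E !formE wE opprB addrC subrK.
Qed.

Lemma omega_formula_unique Pi w w' : connections P Pi ->
  omega_formula P Pi w -> omega_formula P Pi w' -> w = w'.
Proof.
move=> HPi /(omega_formulaE HPi) F /(omega_formulaE HPi) F'.
apply/funext => h; apply: form_ext => x Y.
have [f fh] := translation_extends P h x.
by rewrite (F _ _ _ _ fh) (F' _ _ _ _ fh).
Qed.

Lemma omega_formula_iso : defines_equivariant_affine_iso
  (connections P) (connection_forms P) (gauge_P P) (gauge_F P) (omega_formula P).
Proof.
apply: iso_of_relation.
- by move=> Pi HPi; exists (connection_form_of HPi);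
    [exact: connection_form_ofP|exact: connection_form_of_formula].
- by move=> Pi w w'; exact: omega_formula_unique.
- move=> w Hw; have HD := differentiation_ofP Hw.
  have HPi := connection_ofP HD; exists (connection_of HD) => //.
  have F := connection_form_of_formula HPi.
  have E := (omega_D_formula _ HPi F).1 (connection_of_formula HD).
  by move: F; rewrite (D_formula_inj E (differentiation_of_formula Hw)).
- move=> Pi Pi' w HPi HPi' F F'.
  have Hw : connection_forms P w.
    rewrite (omega_formula_unique HPi F (connection_form_of_formula HPi)).
    exact: connection_form_ofP.
  apply: (@Pi_formula_unique (differentiation_of Hw)).
    exact/(omega_D_formula _ HPi F)/differentiation_of_formula.
  exact/(omega_D_formula _ HPi' F')/differentiation_of_formula.
- exact: connections_affine.
- move=> c Pi Pi' w w' HPi HPi' /(omega_formulaE HPi) F /(omega_formulaE HPi') F'.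
  apply/(omega_formulaE (connections_affine c HPi HPi')) => h x Y f fh.
  by rewrite /affine_comb !formE (F _ _ _ _ fh) (F' _ _ _ _ fh).
- exact: connections_gauge.
- move=> c Pi w HPi /(omega_formulaE HPi) F.
  apply/(omega_formulaE (connections_gauge c HPi)) => h x Y f fh.
  rewrite -[RHS]/(pull_form (diffeo_inv c) (Pi (pull_form c (form_d f))) x Y) pull_form_d.
  apply: F => _ /act_transitive[g <-]; rewrite translation_act /= gauge_act dinvK.
  by rewrite fh ?proj_act // translation_act.
Qed.

Lemma D_formula_iso : defines_equivariant_affine_iso
  (connection_forms P) (covariant_differentiations P)
  (gauge_F P) (gauge_D P) (D_formula P).
Proof.
apply: iso_of_relation.
- by move=> w Hw; exists (differentiation_of Hw); [exact: differentiation_ofP|].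
- by move=> w D D' _; exact: D_formula_unique.
- move=> D HD; have HPi := connection_ofP HD; exists (connection_form_of HPi).
    exact: connection_form_ofP.
  exact/(omega_D_formula _ HPi (connection_form_of_formula HPi))/connection_of_formula.
- by move=> w w' D _ _; exact: D_formula_inj.
- exact: connection_forms_affine.
- move=> c w w' D D' _ _ F F' f x Y.
  by rewrite /affine_comb !formE F F' !formE /=; ring.
- exact: connection_forms_gauge.
- move=> c w D _ F f x Y; rewrite /gauge_D /gauge_F /=.
  rewrite F !formE /= pull_fun_K.
  have -> // : pull_fun (Rx P (dinv c x)) (pull_fun c f) = pull_fun (Rx P x) f.
  by apply: cinf_ext => g /=; rewrite gauge_act dinvK.
Qed.
End Isomorphisms.

Theorem theorem3p11 (R : realType) (X M : manifold R) (G : lie_group R)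
    (P : principal_bundle X M G) :
  [/\ gauge_acts (connections P) (gauge_P P),
      gauge_acts (connection_forms P) (gauge_F P) &
      gauge_acts (covariant_differentiations P) (gauge_D P)] /\
  [/\ defines_equivariant_affine_iso
        (covariant_differentiations P) (connections P)
        (gauge_D P) (gauge_P P) Pi_formula,
      defines_equivariant_affine_iso
        (connections P) (connection_forms P)
        (gauge_P P) (gauge_F P) (omega_formula P) &
      defines_equivariant_affine_iso
        (connection_forms P) (covariant_differentiations P)
        (gauge_F P) (gauge_D P) (D_formula P)].
Proof.
split; split.
- exact: gauge_acts_P.
- exact: gauge_acts_F.
- exact: gauge_acts_D.
- exact: Pi_formula_iso.
- exact: omega_formula_iso.
- exact: D_formula_iso.
Qed.
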